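(* Let $\mathbf{T}=(T_1,\dots,T_d)\in\mathfrak{B}(\mathcal{H})^d$. Then for any $t\in[0,1]$, with $r_0=\min\{t,1-t\}$, $$\|\widehat{\mathbf{T}}(t)\|_h\le 2r_0\|\widetilde{\mathbf{T}}\|_h+(1-2r_0)\|\widehat{\mathbf{T}}\|_h\le\|\widehat{\mathbf{T}}\|_h\le\|\mathbf{T}\|.$$ In particular, $\|\widetilde{\mathbf{T}}\|_h\le\|\widehat{\mathbf{T}}\|_h\le\|\mathbf{T}\|$.
   Context: $\mathcal{H}$ is a separable complex Hilbert space, $\mathfrak{B}(\mathcal{H})$ the bounded linear operators on $\mathcal{H}$, and $d\in\mathbb{N}$. For $\mathbf{T}=(T_1,\dots,T_d)\in\mathfrak{B}(\mathcal{H})^d$, the spherical (joint) operator norm is $\|\mathbf{T}\|=\sup\{(\sum_{k=1}^d\|T_kx\|^2)^{1/2}: x\in\mathcal{H},\ \|x\|=1\}$, and the hypo-norm is $\|\mathbf{T}\|_h=\sup\|\lambda_1T_1+\cdots+\lambda_dT_d\|$ over all $(\lambda_1,\dots,\lambda_d)\in\mathbb{C}^d$ with $\sum_k|\lambda_k|^2\le1$. Canonical spherical polar decomposition: $\mathbf{T}=\mathbf{V}P=(V_1P,\dots,V_dP)$, where $P=\sqrt{T_1^*T_1+\cdots+T_d^*T_d}$ and $\mathbf{V}=(V_1,\dots,V_d)$, viewed as a column operator $\mathcal{H}\to\mathcal{H}^d$, is the partial isometry with initial space $\mathcal{N}(P)^\perp$; that is, $T_i=V_iP$ for all $i$ and $\sum_{i=1}^dV_i^*V_i$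 is the orthogonal projection onto $\mathcal{N}(P)^\perp=\overline{\mathcal{R}(P)}$. The convention $P^0=I$ is used. For $t\in[0,1]$: the generalized spherical Aluthge transform is $\widetilde{\mathbf{T}}(t)=(P^tV_1P^{1-t},\dots,P^tV_dP^{1-t})$; the spherical Aluthge transform is $\widetilde{\mathbf{T}}=\widetilde{\mathbf{T}}(1/2)$; the spherical Duggal transform is $\mathbf{T}^D=(PV_1,\dots,PV_d)$; the spherical mean transform is $\widehat{\mathbf{T}}=\frac12(\mathbf{T}+\mathbf{T}^D)$; the spherical Heinz transform is $\widehat{\mathbf{T}}(t)=\frac12(\widetilde{\mathbf{T}}(t)+\widetilde{\mathbf{T}}(1-t))$ (coordinatewise operations). *)

(* Defs.v *)
From HB Require Import structures.
From mathcomp Require Import all_boot all_order all_algebra.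
From mathcomp Require Import all_classical all_reals all_analysis.
From mathcomp Require Import sesquilinear complex.

Set Implicit Arguments.
Unset Strict Implicit.
Unset Printing Implicit Defensive.

Import Order.TTheory GRing.Theory Num.Theory.
Import numFieldNormedType.Exports.

Local Open Scope classical_set_scope.
Local Open Scope ring_scope.
Local Open Scope complex_scope.

(* Operators are plain functions H -> H; membership in B(H) is [bounded_op].
   Operators characterised uniquely by a property (adjoint, square root, polar
   factor, power) are selected by [get], which returns an arbitrary value if no
   operator has the property. *)

Section Separable.
Variable T : topologicalType.

Definition separable_space : Prop := exists D : set T, countable D /\ dense D.

End Separable.

Section Norms.
Variables (R : realType) (H : completeNormedModType R[i]).

Definition bounded_op (A : H -> H) : Prop :=
  linear A /\ exists M : R[i], forall x : H, `|A x| <= M * `|x|.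

(* The norm of H has values in R[i]; suprema are taken in R. *)
Definition rnorm (x : H) : R := complex.Re `|x|.

(* Here and below [sup] is 0 on the empty set, which is the value of the
   suprema over the unit sphere when H = 0. It is also 0 on sets without
   upper bound, so these norms are meaningful on bounded operators only. *)
Definition opnorm (A : H -> H) : R :=
  sup [set rnorm (A x) | x in [set x : H | `|x| = 1]].

Definition spherical_norm d (T : 'I_d -> H -> H) : R :=
  sup [set Num.sqrt (\sum_(k < d) rnorm (T k x) ^+ 2)
      | x in [set x : H | `|x| = 1]].

Definition hypo_norm d (T : 'I_d -> H -> H) : R :=
  sup [set opnorm (fun x : H => \sum_(k < d) lam k *: T k x)
      | lam in [set lam : 'I_d -> R[i] | \sum_(k < d) `|lam k| ^+ 2 <= 1]].

End Norms.

Section Powers.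
Variables (R : realType) (H : completeNormedModType R[i]).

Definition poly_op (p : {poly R}) (A : H -> H) : H -> H :=
  fun x => \sum_(i < size p) (p`_i)%:C *: iter i A x.

(* Continuous functional calculus of a positive operator A: B = f(A) is the
   norm limit of p_n(A), for polynomials p_n converging to f uniformly on the
   interval [0, ||A||], which contains the spectrum of A. *)
Definition is_fun_calc (f : R -> R) (A B : H -> H) : Prop :=
  bounded_op B /\
  exists p : nat -> {poly R},
    {uniform `[0, opnorm A], (fun n (s : R) => (p n).[s]) @ \oo --> f} /\
    opnorm (fun x => poly_op (p n) A x - B x) @[n --> \oo] --> (0 : R).

(* As 0 `^ 0 = 1 for [powR], this gives A^0 = I. *)
Definition op_pow (A : H -> H) (t : R) : H -> H :=
  get (is_fun_calc (fun s => s `^ t) A).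

End Powers.

Section PolarDecomposition.
Variables (R : realType) (H : completeNormedModType R[i]).
Variable dot : {dot H for Num.conj}.

Definition adjoint (A : H -> H) : H -> H :=
  get [set B | bounded_op B /\ forall x y, dot (A x) y = dot x (B y)].

(* [0 <= z] in R[i] means that z is real and nonnegative. *)
Definition positive_op (A : H -> H) : Prop :=
  bounded_op A /\ forall x, 0 <= dot (A x) x.

Definition op_sqrt (A : H -> H) : H -> H :=
  get [set B | positive_op B /\ forall x, B (B x) = A x].

Definition ortho_compl (M : set H) : set H :=
  [set x | forall y, M y -> dot x y = 0].

Definition is_orthoproj (M : set H) (Q : H -> H) : Prop :=
  forall x, M (Q x) /\ ortho_compl M (x - Q x).

Definition op_ker (A : H -> H) : set H := [set x | A x = 0].

Definition sum_adj_mul d (T : 'I_d -> H -> H) : H -> H :=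
  fun x => \sum_(k < d) adjoint (T k) (T k x).

Definition polar_abs d (T : 'I_d -> H -> H) : H -> H :=
  op_sqrt (sum_adj_mul T).

Definition polar_isom d (T : 'I_d -> H -> H) : 'I_d -> H -> H :=
  get [set V | [/\ forall k, bounded_op (V k),
                   forall k x, T k x = V k (polar_abs T x) &
                   is_orthoproj (ortho_compl (op_ker (polar_abs T)))
                     (sum_adj_mul V)]].

Definition gen_aluthge d (T : 'I_d -> H -> H) (t : R) : 'I_d -> H -> H :=
  fun k x => op_pow (polar_abs T) t
               (polar_isom T k (op_pow (polar_abs T) (1 - t) x)).

Definition aluthge d (T : 'I_d -> H -> H) : 'I_d -> H -> H :=
  gen_aluthge T 2^-1.

Definition duggal d (T : 'I_d -> H -> H) : 'I_d -> H -> H :=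
  fun k x => polar_abs T (polar_isom T k x).

Definition mean_transform d (T : 'I_d -> H -> H) : 'I_d -> H -> H :=
  fun k x => 2^-1 *: (T k x + duggal T k x).

Definition heinz d (T : 'I_d -> H -> H) (t : R) : 'I_d -> H -> H :=
  fun k x => 2^-1 *: (gen_aluthge T t k x + gen_aluthge T (1 - t) k x).

End PolarDecomposition.

(* Main.v *)
Require Import Defs.
From mathcomp Require Import all_boot all_order all_algebra.
From mathcomp Require Import all_classical all_reals all_analysis.
From mathcomp Require Import sesquilinear complex.
From mathcomp Require Import ring lra.

Set Implicit Arguments.
Unset Strict Implicit.
Unset Printing Implicit Defensive.

Import Order.TTheory GRing.Theory Num.Theory.
Import numFieldNormedType.Exports.

(** Fix scalars [lam] of Euclidean length at most 1, put [S = sum_k lam_k V_k]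
    and let
<<
      H(t) = (P^t S P^(1-t) + P^(1-t) S P^t) / 2 .
>>
    The combinations with coefficients [lam] of the Heinz, Aluthge and mean
    transforms of [T] are [H(t)], [H(1/2)] and [H(0)]
    ([lincomb_heinz], [lincomb_aluthge], [lincomb_mean]), so the first two
    inequalities say that the norm of [H], which is symmetric about 1/2, lies
    below its chord on [[0, 1/2]] and is smallest at 1/2.  Both follow from
    convexity of [t |-> ||H(t)||].

    Midpoint convexity is the operator inequality
    [2 ||A X A|| <= ||A^2 X + X A^2||] for selfadjoint [A]
    ([arithmetic_geometric_opnorm]), applied to [A = P^h] and
    [X = (P^(s-h) S P^(1-s-h) + P^(1-s-h) S P^(s-h)) / 2].  It is proved with
    near-maximising unit vectors [x] of [K = A X A]: with [a = A x] and
    [b = A K x / ||K||], the number [<(A^2 X + X A^2) a, b>] is nearly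
    [||K|| (|a|^2 + |b|^2)].  A midpoint convex function that is bounded lies
    below its chords ([midpoint_convex_chord]); this avoids continuity of
    [t |-> P^t], which can fail in norm at [t = 0].

    The last inequality holds because [sum_k |V_k x|^2 <= |x|^2] makes [S] a
    contraction, while [||P||] is the spherical norm of [T], whence
    [||S P + P S|| <= 2 ||P||].

    The operators chosen by [get] must be shown to exist.  Adjoints and the
    polar factor come from one representation lemma
    ([riesz_representation]).  Square root and powers come from a continuous
    functional calculus ([fun_calc_exists]), which rests on two facts: powers
    are uniform limits of polynomials ([powR_polynomial_approximation], by
    Bernstein polynomials), and [||p(A)||] is at most the maximum of [|p|] on
    [[0, ||A||]] for positive [A] ([poly_op_norm_le]).  The latter is proved
    without spectra: a real polynomial without zeros on that interval factors
    over the complex numbers into factors [A - z] that are bounded below. *)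

Local Open Scope classical_set_scope.
Local Open Scope ring_scope.
Local Open Scope complex_scope.

Local Notation Re := complex.Re.
Local Notation Im := complex.Im.

(** * Norms and bounded operators *)

Section RealNorm.
Variables (R : realType) (H : completeNormedModType R[i]).
Implicit Types (x y : H) (A B : H -> H) (c : R).

Lemma norm_rnorm x : `|x| = (rnorm x)%:C.
Proof. by rewrite /rnorm RRe_real // normr_real. Qed.

Lemma rnorm_ge0 x : 0 <= rnorm x.
Proof. by rewrite -ler0c -norm_rnorm. Qed.

Lemma rnorm0 : rnorm (0 : H) = 0.
Proof. by rewrite /rnorm normr0. Qed.

Lemma rnorm_eq0 x : (rnorm x == 0) = (x == 0).
Proof. by rewrite -(normr_eq0 x) norm_rnorm -(inj_eq (@complexI R)) rmorph0. Qed.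

Lemma rnormD x y : rnorm (x + y) <= rnorm x + rnorm y.
Proof. by rewrite -lecR rmorphD /= -!norm_rnorm ler_normD. Qed.

Lemma rnormN x : rnorm (- x) = rnorm x.
Proof. by rewrite /rnorm normrN. Qed.

Lemma rnormB x y : rnorm (x - y) <= rnorm x + rnorm y.
Proof. by rewrite -(rnormN y) rnormD. Qed.

Lemma rdistC x y : rnorm (x - y) = rnorm (y - x).
Proof. by rewrite -rnormN opprB. Qed.

Lemma rdist_triangle x y z : rnorm (x - z) <= rnorm (x - y) + rnorm (y - z).
Proof. by apply: le_trans (rnormD _ _); rewrite addrA subrK. Qed.

Lemma Re_norm_ge0 (a : R[i]) : 0 <= Re `|a|.
Proof. by have := normr_ge0 a; rewrite lecE /= => /andP[_]. Qed.

Lemma rnormZ (a : R[i]) x : rnorm (a *: x) = Re `|a| * rnorm x.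
Proof.
apply: complexI; rewrite rmorphM /= -!norm_rnorm normrZ; congr (_ * _).
Qed.

Lemma rnormZr c x : rnorm (c%:C *: x) = `|c| * rnorm x.
Proof.
rewrite rnormZ; congr (_ * _).
by rewrite normc_def /= expr0n addr0 sqrtr_sqr.
Qed.

Lemma eq1_rnorm x : (`|x| = 1) <-> (rnorm x = 1).
Proof.
rewrite norm_rnorm; split=> [h|->//].
by apply: complexI; rewrite h.
Qed.

Lemma unit_vec x : x != 0 -> rnorm ((rnorm x)^-1%:C *: x) = 1.
Proof.
move=> x0; rewrite rnormZr ger0_norm ?invr_ge0 ?rnorm_ge0 //.
by rewrite mulVf // rnorm_eq0.
Qed.

End RealNorm.

Section LinearFun.
Variables (R : realType) (H : completeNormedModType R[i]).
Variable A : H -> H.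
Hypothesis linA : linear A.

Lemma linfD x y : A (x + y) = A x + A y.
Proof. by have := linA 1 x y; rewrite !scale1r. Qed.

Lemma linf0 : A 0 = 0.
Proof. by apply: (addIr (A 0)); rewrite -linfD !add0r. Qed.

Lemma linfZ a x : A (a *: x) = a *: A x.
Proof. by rewrite -[a *: x]addr0 linA linf0 addr0. Qed.

Lemma linfN x : A (- x) = - A x.
Proof. by rewrite -scaleN1r linfZ scaleN1r. Qed.

Lemma linfB x y : A (x - y) = A x - A y.
Proof. by rewrite linfD linfN. Qed.

Lemma linf_sum (I : Type) (r : seq I) (Q : pred I) (F : I -> H) :
  A (\sum_(i <- r | Q i) F i) = \sum_(i <- r | Q i) A (F i).
Proof. exact: (big_morph A linfD linf0). Qed.

End LinearFun.

Section BoundedOp.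
Variables (R : realType) (H : completeNormedModType R[i]).
Implicit Types (x y : H) (A B : H -> H) (c M : R).

Lemma bounded_opI A M : linear A -> (forall x, rnorm (A x) <= M * rnorm x) ->
  bounded_op A.
Proof.
move=> lA hA; split=> //; exists M%:C => x.
by rewrite !norm_rnorm -rmorphM /= lecR.
Qed.

Lemma bounded_op_linear A : bounded_op A -> linear A.
Proof. by case. Qed.

Lemma bounded_opE A : bounded_op A ->
  exists2 M, 0 <= M & forall x, rnorm (A x) <= M * rnorm x.
Proof.
move=> [_ [M hM]]; exists (Re `|M|) => [|x].
  by have := normr_ge0 M; rewrite lecE /= => /andP[_].
rewrite -rnormZ.
have : `|A x| <= `|M *: x|.
  by rewrite normrZ -[`|x|]normr_id -normrM real_ler_normr ?ger0_real ?hM //;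
     exact: le_trans (hM x).
by rewrite !norm_rnorm lecR.
Qed.

Lemma opnorm_le A c : 0 <= c -> (forall x, rnorm (A x) <= c * rnorm x) ->
  opnorm A <= c.
Proof.
move=> c0 hA; rewrite /opnorm; set S := (X in sup X).
have [->|S0] := eqVneq S set0; first by rewrite sup0.
apply: ge_sup; first by apply/set0P.
by move=> _ [x /eq1_rnorm x1 <-]; rewrite (le_trans (hA x)) // x1 mulr1.
Qed.

Lemma opnorm_ge0 A : 0 <= opnorm A.
Proof.
rewrite /opnorm; set S := (X in sup X).
have [hS|/sup_out -> //] := pselect (has_sup S).
have [[y Sy] _] := hS; apply: le_trans (sup_upper_bound hS Sy).
by case: Sy => x _ <-; exact: rnorm_ge0.
Qed.

Lemma opnorm_ub A x : bounded_op A -> rnorm (A x) <= opnorm A * rnorm x.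
Proof.
move=> bA; have [lA _] := bA; have [M M0 hM] := bounded_opE bA.
have [->|x0] := eqVneq x 0; first by rewrite linf0 // rnorm0 mulr0.
have nx : 0 < rnorm x by rewrite lt_neqAle rnorm_ge0 eq_sym rnorm_eq0 x0.
rewrite -ler_pdivrMr // mulrC.
apply: sup_upper_bound.
  split; first by exists (rnorm (A ((rnorm x)^-1%:C *: x))) => /=;
    exists ((rnorm x)^-1%:C *: x) => //; apply/eq1_rnorm; exact: unit_vec.
  by exists M => _ [y /eq1_rnorm y1 <-]; rewrite (le_trans (hM y)) // y1 mulr1.
exists ((rnorm x)^-1%:C *: x); first by apply/eq1_rnorm; exact: unit_vec.
by rewrite linfZ // rnormZr ger0_norm // invr_ge0 rnorm_ge0.
Qed.

Lemma linear_id_fun : linear (fun x : H => x).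
Proof. by move=> a x y. Qed.

Lemma linear_comp_fun A B : linear A -> linear B -> linear (A \o B).
Proof. by move=> lA lB a x y; rewrite /= lB lA. Qed.

Lemma linear_add_fun A B : linear A -> linear B -> linear (fun x => A x + B x).
Proof. by move=> lA lB a x y; rewrite lA lB scalerDr addrACA. Qed.

Lemma linear_scale_fun a A : linear A -> linear (fun x => a *: A x).
Proof.
by move=> lA b x y; rewrite lA scalerDr !scalerA mulrC.
Qed.

Lemma bounded_id : bounded_op (fun x : H => x).
Proof. by apply: (@bounded_opI _ 1) => [|x]; rewrite ?mul1r; first exact: linear_id_fun. Qed.

Lemma bounded_comp A B : bounded_op A -> bounded_op B ->
  bounded_op (fun x => A (B x)).
Proof.
move=> bA bB; have [[lA _] [lB _]] := (bA, bB).
apply: (@bounded_opI _ (opnorm A * opnorm B)); first exact: linear_comp_fun.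
move=> x; rewrite (le_trans (opnorm_ub _ bA)) // -mulrA.
by rewrite ler_wpM2l ?opnorm_ge0 ?opnorm_ub.
Qed.

Lemma bounded_add A B : bounded_op A -> bounded_op B ->
  bounded_op (fun x => A x + B x).
Proof.
move=> bA bB; have [[lA _] [lB _]] := (bA, bB).
apply: (@bounded_opI _ (opnorm A + opnorm B)); first exact: linear_add_fun.
move=> x; rewrite (le_trans (rnormD _ _)) // mulrDl.
by rewrite lerD ?opnorm_ub.
Qed.

Lemma bounded_scale a A : bounded_op A -> bounded_op (fun x => a *: A x).
Proof.
move=> bA; have [lA _] := bA.
apply: (@bounded_opI _ (Re `|a| * opnorm A)); first exact: linear_scale_fun.
move=> x; rewrite rnormZ -mulrA ler_wpM2l ?opnorm_ub //.
exact: Re_norm_ge0.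
Qed.

Lemma bounded_sum (I : Type) (r : seq I) (F : I -> H -> H) :
  (forall i, bounded_op (F i)) -> bounded_op (fun x => \sum_(i <- r) F i x).
Proof.
move=> bF; elim: r => [|i r IH].
  apply: (@bounded_opI _ 0) => [a x y|x]; rewrite !big_nil ?scaler0 ?addr0 //.
  by rewrite rnorm0 mul0r.
rewrite (_ : (fun x => _) = (fun x => F i x + \sum_(j <- r) F j x)).
  exact: bounded_add.
by apply/funext => x; rewrite big_cons.
Qed.

Lemma opnorm_add A B : bounded_op A -> bounded_op B ->
  opnorm (fun x => A x + B x) <= opnorm A + opnorm B.
Proof.
move=> bA bB; apply: opnorm_le => [|x]; first by rewrite addr_ge0 ?opnorm_ge0.
rewrite (le_trans (rnormD _ _)) // mulrDl.
by rewrite lerD ?opnorm_ub.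
Qed.

End BoundedOp.

(** * The real part of the inner product *)

Section InnerProduct.
Variables (R : realType) (H : completeNormedModType R[i]).
Variable dot : {dot H for Num.conj}.
Hypothesis dot_norm : forall x : H, dot x x = `|x| ^+ 2.
Implicit Types (x y z : H).

(** The estimates below involve real parts of inner products only; a complex
    identity is recovered from them by rotating one argument. *)
Definition rdot x y : R := Re (dot x y).

Lemma dotC x y : dot y x = Num.conj (dot x y).
Proof. by rewrite (hermC dot y x) /= expr0 mul1r. Qed.

Lemma dotDl x y z : dot (x + y) z = dot x z + dot y z.
Proof. exact: linearDl. Qed.
Lemma dotDr x y z : dot z (x + y) = dot z x + dot z y.
Proof. exact: linearDr. Qed.
Lemma dotNl x z : dot (- x) z = - dot x z.
Proof. exact: linearNl. Qed.
Lemma dotNr x z : dot z (- x) = - dot z x.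
Proof. exact: linearNr. Qed.
Lemma dotZl a x z : dot (a *: x) z = a * dot x z.
Proof. exact: linearZl_LR. Qed.
Lemma dotZr a x z : dot z (a *: x) = Num.conj a * dot z x.
Proof. exact: linearZr_LR. Qed.
Lemma dot0l x : dot 0 x = 0.
Proof. exact: linear0l. Qed.
Lemma dot0r x : dot x 0 = 0.
Proof. exact: linear0r. Qed.
Lemma dotBl x y z : dot (x - y) z = dot x z - dot y z.
Proof. exact: linearBl. Qed.
Lemma dotBr x y z : dot z (x - y) = dot z x - dot z y.
Proof. exact: linearBr. Qed.
Lemma dot_suml (I : Type) (r : seq I) (F : I -> H) z :
  dot (\sum_(i <- r) F i) z = \sum_(i <- r) dot (F i) z.
Proof. exact: linear_sumlz. Qed.
Lemma dot_sumr (I : Type) (r : seq I) (F : I -> H) z :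
  dot z (\sum_(i <- r) F i) = \sum_(i <- r) dot z (F i).
Proof. exact: linear_sumr. Qed.

Lemma cReD (a b : R[i]) : Re (a + b) = Re a + Re b.
Proof. by case: a; case: b. Qed.
Lemma cReN (a : R[i]) : Re (- a) = - Re a.
Proof. by case: a. Qed.
Lemma cRe_sum (I : Type) (r : seq I) (F : I -> R[i]) :
  Re (\sum_(i <- r) F i) = \sum_(i <- r) Re (F i).
Proof. exact: (big_morph _ cReD). Qed.
Lemma cReM (c : R) (a : R[i]) : Re (c%:C * a) = c * Re a.
Proof. by case: a => a b /=; rewrite mul0r subr0. Qed.
Lemma cRe_conj (a : R[i]) : Re (Num.conj a) = Re a.
Proof. by case: a. Qed.
Lemma conj_real (c : R) : Num.conj (c%:C) = c%:C.
Proof. exact: conjc_real. Qed.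

Lemma rdotC x y : rdot x y = rdot y x.
Proof. by rewrite /rdot dotC cRe_conj. Qed.
Lemma rdotDl x y z : rdot (x + y) z = rdot x z + rdot y z.
Proof. by rewrite /rdot dotDl cReD. Qed.
Lemma rdotDr x y z : rdot z (x + y) = rdot z x + rdot z y.
Proof. by rewrite /rdot dotDr cReD. Qed.
Lemma rdotNl x z : rdot (- x) z = - rdot x z.
Proof. by rewrite /rdot dotNl cReN. Qed.
Lemma rdotNr x z : rdot z (- x) = - rdot z x.
Proof. by rewrite /rdot dotNr cReN. Qed.
Lemma rdotZl (c : R) x z : rdot (c%:C *: x) z = c * rdot x z.
Proof. by rewrite /rdot dotZl cReM. Qed.
Lemma rdotZr (c : R) x z : rdot z (c%:C *: x) = c * rdot z x.
Proof. by rewrite /rdot dotZr conj_real cReM. Qed.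
Definition rdotE := (rdotDl, rdotDr, rdotNl, rdotNr, rdotZl, rdotZr).

Lemma dot_rnorm x : dot x x = (rnorm x ^+ 2)%:C.
Proof. by rewrite dot_norm norm_rnorm rmorphXn. Qed.

Lemma rdotxx x : rdot x x = rnorm x ^+ 2.
Proof. by rewrite /rdot dot_rnorm. Qed.

Lemma rnorm_sqD x y : rnorm (x + y) ^+ 2 =
  rnorm x ^+ 2 + rdot x y *+ 2 + rnorm y ^+ 2.
Proof. by rewrite -!rdotxx !rdotE (rdotC y x); ring. Qed.

Lemma rnorm_sqB x y : rnorm (x - y) ^+ 2 =
  rnorm x ^+ 2 - rdot x y *+ 2 + rnorm y ^+ 2.
Proof. by rewrite rnorm_sqD rdotNr rnormN mulNrn. Qed.

(** Discriminant form of the Cauchy-Schwarz inequality. It serves the inner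
    product, finite sums, the minimisation in the representation lemma and the
    form [||K||^2 <x, u> - <K x, K u>]. *)
Lemma psd_CauchySchwarz (a b c : R) : 0 <= c ->
  (forall t, 0 <= a + t * b *+ 2 + t ^+ 2 * c) -> b ^+ 2 <= a * c.
Proof.
rewrite le_eqVlt => /predU1P[<-|c0] h.
  have [->|b0] := eqVneq b 0; first by rewrite mulr0 expr0n.
  have := h (- (a + 1) / (b *+ 2)).
  rewrite mulr0 addr0 -mulrnAr mulfVK ?mulrn_eq0 //; lra.
have := h (- b / c).
have -> : a + - b / c * b *+ 2 + (- b / c) ^+ 2 * c = (a * c - b ^+ 2) / c.
  by field; rewrite gt_eqF.
by rewrite pmulr_lge0 ?invr_gt0 // subr_ge0.
Qed.

Lemma rdot_sq_le x y : rdot x y ^+ 2 <= rnorm x ^+ 2 * rnorm y ^+ 2.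
Proof.
apply: psd_CauchySchwarz => [|t]; first exact: sqr_ge0.
have := sqr_ge0 (rnorm (x + t%:C *: y)).
by rewrite rnorm_sqD rdotZr rnormZr exprMn real_normK ?num_real.
Qed.

Lemma rdot_le x y : `|rdot x y| <= rnorm x * rnorm y.
Proof.
rewrite -(@ler_pXn2r _ 2) ?nnegrE ?mulr_ge0 ?rnorm_ge0 //.
by rewrite real_normK ?num_real // exprMn rdot_sq_le.
Qed.

End InnerProduct.

(** * Completeness and Riesz representation *)

Section Completeness.
Variables (R : realType) (H : completeNormedModType R[i]).

(** Completeness for nested approximations: [E e] is the set of elements known to
    lie within [e] of the limit to be built. Limits are thus obtained without
    choosing sequences. *)
Lemma complete_approx (E : R -> set H) :
  (forall e, 0 < e -> exists x, E e x) ->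
  (forall e e' x y, E e x -> E e' y -> rnorm (x - y) <= e + e') ->
  exists l, forall e x, 0 < e -> E e x -> rnorm (x - l) <= e.
Proof.
move=> E0 Ecauchy.
have invS0 n : 0 < n.+1%:R^-1 :> R by rewrite invr_gt0.
have /choice[u Eu] n : exists x, E n.+1%:R^-1 x by exact: E0.
have smallN (e : R) : 0 < e -> exists N, forall n, (N <= n)%N -> n.+1%:R^-1 < e.
  move=> e0; have [N _ hN] := near_infty_natSinv_lt (PosNum e0).
  by exists N => n; exact: hN.
have : cauchy (u @ \oo).
  apply/cauchy_ballP => e e0.
  have eE : e = (Re e)%:C by rewrite RRe_real // gtr0_real.
  have re0 : 0 < Re e / 2 by rewrite divr_gt0 // -ltcR -eE.
  have [N hN] := smallN _ re0.
  pose tail := [set u n | n in [set n | (N <= n)%N]].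
  exists (tail, tail) => [|[_ _] /= [[m Nm <-] [n Nn <-]]].
    by split; exists N => // n Nn; exists n.
  rewrite -ball_normE /ball_ /= norm_rnorm eE ltcR.
  apply: le_lt_trans (Ecauchy _ _ _ _ (Eu m) (Eu n)) _.
  by rewrite [ltRHS]splitr ltrD // hN.
move=> /cauchy_cvgP/cvg_ex[/= l ul]; exists l => e x e0 Ex.
apply/ler_addgt0Pr => d d0.
have d20 : 0 < d / 2 by rewrite divr_gt0.
have [N hN] := smallN _ d20.
have dC0 : 0 < (d / 2)%:C by rewrite ltcR.
have /cvgrPdist_lt/(_ _ dC0)[N' _ hN'] := ul.
pose n := maxn N N'.
have := hN' n (leq_maxr _ _); rewrite /= norm_rnorm ltcR => ln.
have := hN n (leq_maxl _ _); have := Ecauchy _ _ _ _ Ex (Eu n).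
have := rdist_triangle x (u n) l; rewrite (rdistC (u n)).
move: ln (_^-1) => ? ? ? ? ?; lra.
Qed.

End Completeness.

Section Representation.
Variables (R : realType) (H : completeNormedModType R[i]).
Variable dot : {dot H for Num.conj}.
Hypothesis dot_norm : forall x : H, dot x x = `|x| ^+ 2.
Implicit Types (x y z : H) (A B : H -> H).

Lemma eq0_small (a c : R) : 0 <= c -> (forall e, 0 < e -> `|a| <= c * e) -> a = 0.
Proof.
move=> c0 h; apply/normr0_eq0/le_anti; rewrite normr_ge0 andbT.
apply/ler_addgt0Pr => e e0; rewrite add0r.
have e' : 0 < e / (c + 1) by rewrite divr_gt0 // ltr_wpDl.
apply: le_trans (h _ e') _.
by rewrite mulrCA ler_piMr ?(ltW e0) // ler_pdivrMr ?ltr_wpDl // mul1r lerDl.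
Qed.

Lemma dot_extl u v : (forall x, dot x u = dot x v) -> u = v.
Proof.
move=> h; apply/eqP; rewrite -subr_eq0 -rnorm_eq0 -sqrf_eq0.
by rewrite -(rdotxx dot_norm) /rdot dotBr h subrr.
Qed.

(** Only [a = 1] and [a = 'i] matter: they give the real and the imaginary part. *)
Lemma dot_Re_eq (u v w z : H) :
  (forall a, rdot dot (a *: u) v = rdot dot (a *: w) z) -> dot u v = dot w z.
Proof.
move=> h; have h1 := h 1; have hi := h 'i.
move: h1 hi; rewrite /rdot !scale1r !dotZl.
case: (dot u v) => a b; case: (dot w z) => a' b' /= -> .
by rewrite !mul0r !mul1r !sub0r => /oppr_inj ->.
Qed.

Section Riesz.
Variables (A : H -> H) (psi : H -> R[i]) (C : R).
Hypothesis linA : linear A.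
Hypothesis linpsi : forall a x y, psi (a *: x + y) = a * psi x + psi y.
Hypothesis psi_le : forall x, `|Re (psi x)| <= C * rnorm (A x).

Let J y := rnorm (A y) ^+ 2 - (Re (psi y)) *+ 2.

Let psiD y z : Re (psi (y + z)) = Re (psi y) + Re (psi z).
Proof. by rewrite -[y]scale1r linpsi !scale1r mul1r cReD. Qed.

Let psiZ (t : R) y : Re (psi (t%:C *: y)) = t * Re (psi y).
Proof.
have psi0 : psi 0 = 0.
  have := linpsi (-1) 0 0; rewrite scaler0 addr0 mulN1r.
  by rewrite addNr.
by rewrite -[t%:C *: y]addr0 linpsi psi0 addr0 cReM.
Qed.

Let J_lb y : - C ^+ 2 <= J y.
Proof.
have := psi_le y; rewrite ler_norml => /andP[_].
have := sqr_ge0 (rnorm (A y) - C); rewrite /J; lra.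
Qed.

Let m := inf (range J).

Let J_ge_m y : m <= J y.
Proof.
apply: ge_inf; last by exists y.
by exists (- C ^+ 2) => _ [x _ <-].
Qed.

Let J_near_m (e : R) : 0 < e -> exists y, J y <= m + e.
Proof.
move=> e0; have hJ : has_inf (range J).
  split; first by exists (J 0), 0.
  by exists (- C ^+ 2) => _ [x _ <-].
have [_ [y _ <-]] := inf_adherent e0 hJ.
by move=> /ltW h; exists y.
Qed.

(** Minimise [|A y|^2 - 2 Re (psi y)]: by the parallelogram identity the values
    [A y] at near-minimisers [y] form a Cauchy family, and its limit [z] satisfies
    the Euler equation. With [A] the identity this is the Riesz theorem; for other
    [A] it represents a functional that factors through the range of [A] by a
    vector of the closure of that range. *)
Lemma riesz_representation : exists z,
  (forall e, 0 < e -> exists y, rnorm (A y - z) <= e) /\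
  forall y, psi y = dot (A y) z.
Proof.
(* an excess of [e^2 / 2] makes the values at two near-minimisers
   [e + e'] close, by the parallelogram identity *)
pose E e := [set w | exists2 y, w = A y & J y <= m + e ^+ 2 / 2 /\ 0 < e].
have [|e e' _ _ [y -> [Jy e0]] [y' -> [Jy' e0']]|z hz] := @complete_approx R H E.
- move=> e e0; have [|y Jy] := @J_near_m (e ^+ 2 / 2).
    by rewrite divr_gt0 // exprn_gt0.
  by exists (A y); exists y.
- rewrite -(@ler_pXn2r _ 2) ?nnegrE ?rnorm_ge0 ?addr_ge0 ?(ltW e0) ?(ltW e0') //.
  have := J_ge_m ((2^-1)%:C *: (y + y')).
  rewrite /J psiZ psiD linfZ // linfD // rnormZr exprMn real_normK ?num_real //.
  have := mulr_gt0 e0 e0'.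
  move: Jy Jy'; rewrite /J (rnorm_sqD dot_norm) (rnorm_sqB dot_norm).
  set p := rdot _ _ _; lra.
exists z; split=> [e e0|].
  have [|y Jy] := @J_near_m (e ^+ 2 / 2); first by rewrite divr_gt0 // exprn_gt0.
  by exists y; apply: hz => //; exists y.
suff reE y : Re (psi y) = rdot dot (A y) z.
  move=> y; have h1 := reE y; have := reE ('i *: y).
  have -> : psi ('i *: y) = 'i * psi y.
    have := linpsi (-1) 0 0; rewrite scaler0 addr0 mulN1r addNr => psi0.
    by rewrite -['i *: y]addr0 linpsi psi0 addr0.
  move: h1; rewrite linfZ // /rdot dotZl.
  case: (psi y) => a b; case: (dot _ _) => a' b' /= -> .
  by rewrite !mul0r !mul1r !sub0r => /oppr_inj ->.
apply/eqP; rewrite -subr_eq0; apply/eqP.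
apply: (@eq0_small _ (rnorm (A y) *+ 2)); first by rewrite mulrn_wge0 ?rnorm_ge0.
move=> e e0; have [|y0 Jy0] := @J_near_m (e ^+ 2 / 2).
  by rewrite divr_gt0 // exprn_gt0.
have wz : rnorm (A y0 - z) <= e by apply: hz => //; exists y0.
have near1 : `|Re (psi y) - rdot dot (A y) (A y0)| <= e * rnorm (A y).
  rewrite -(@ler_pXn2r _ 2) ?nnegrE ?mulr_ge0 ?rnorm_ge0 ?(ltW e0) //.
  rewrite real_normK ?num_real // exprMn.
  have h : (rdot dot (A y) (A y0) - Re (psi y)) ^+ 2 <= e ^+ 2 / 2 * rnorm (A y) ^+ 2.
    apply: psd_CauchySchwarz => [|t]; first exact: sqr_ge0.
    have := J_ge_m (y0 + t%:C *: y); move: Jy0.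
    rewrite /J psiD psiZ linfD // linfZ // (rnorm_sqD dot_norm) rnormZr exprMn.
    rewrite real_normK ?num_real // rdotZr (rdotC dot (A y0)); lra.
  have := sqr_ge0 (e * rnorm (A y)); rewrite exprMn.
  move: h; rewrite -[X in X <= _]sqrrN opprB; lra.
have near2 : `|rdot dot (A y) (A y0 - z)| <= rnorm (A y) * e.
  apply: le_trans (rdot_le dot_norm _ _) _.
  by rewrite ler_wpM2l ?rnorm_ge0.
have -> : Re (psi y) - rdot dot (A y) z =
  (Re (psi y) - rdot dot (A y) (A y0)) + rdot dot (A y) (A y0 - z).
  by rewrite !rdotE; ring.
apply: le_trans (ler_normD _ _) _; lra.
Qed.

End Riesz.

Lemma adjoint_pair_bounded B W : bounded_op B ->
  (forall x y, dot (B x) y = dot x (W y)) -> bounded_op W.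
Proof.
move=> bB hW; apply: (@bounded_opI _ _ _ (opnorm B)) => [a x y|y].
  by apply: dot_extl => z; rewrite -hW !dotDr !dotZr !hW.
have [->|W0] := eqVneq (W y) 0; first by rewrite rnorm0 mulr_ge0 ?opnorm_ge0 ?rnorm_ge0.
have nW : 0 < rnorm (W y) by rewrite lt_neqAle rnorm_ge0 eq_sym rnorm_eq0 W0.
rewrite -(ler_pM2l nW) -expr2 -(rdotxx dot_norm) /rdot -hW -/(rdot dot _ _).
apply: le_trans (ler_norm _) _; apply: le_trans (rdot_le dot_norm _ _) _.
rewrite mulrA ler_wpM2r ?rnorm_ge0 // mulrC; exact: opnorm_ub.
Qed.

Lemma adjointP B : bounded_op B ->
  bounded_op (adjoint dot B) /\ forall x y, dot (B x) y = dot x (adjoint dot B y).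
Proof.
move=> bB; have [lB _] := bB.
suff /choice[W hW] : forall y, exists w, forall x, dot (B x) y = dot x w.
  have bW : bounded_op W by apply: adjoint_pair_bounded bB _ => x y; exact: hW.
  by apply: (@getPex _ [set B' | bounded_op B' /\
    forall x y, dot (B x) y = dot x (B' y)]); exists W; split.
move=> y; have [|||w [_ hw]] := @riesz_representation (fun x => x)
    (fun x => dot (B x) y) (opnorm B * rnorm y).
- exact: linear_id_fun.
- by move=> a u v; rewrite lB dotDl dotZl.
- move=> x; apply: le_trans (rdot_le dot_norm _ _) _.
  by rewrite mulrAC ler_wpM2r ?rnorm_ge0 ?opnorm_ub.
by exists w.
Qed.

Lemma adjoint_unique B W : bounded_op B ->
  (forall x y, dot (B x) y = dot x (W y)) -> forall y, adjoint dot B y = W y.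
Proof.
by move=> bB hW y; have [_ h] := adjointP bB; apply: dot_extl => x; rewrite -h hW.
Qed.

Definition selfadjoint A := forall x y, dot (A x) y = dot x (A y).

(** Polarisation: the form [<A u, v> - <u, A v>] vanishes on the diagonal, and over
    the complex numbers such a form is zero. *)
Lemma positive_selfadjoint A : positive_op dot A -> selfadjoint A.
Proof.
move=> [[lA _] posA] x y.
pose B u v := dot (A u) v - dot u (A v).
have B0 u : B u u = 0.
  rewrite /B [X in _ - X]dotC; have := posA u => /ger0_real/CrealP ->.
  by rewrite subrr.
have BD u v : B u v + B v u = 0.
  have := B0 (u + v).
  have -> : B (u + v) (u + v) = B u u + B v v + (B u v + B v u).
    by rewrite /B linfD // !dotDl !dotDr; ring.
  by rewrite !B0 !add0r.
have BI : - 'i * B x y + 'i * B y x = 0.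
  rewrite -(BD x ('i *: y)) /B linfZ // !dotZl !dotZr.
  have -> : Num.conj ('i : R[i]) = - 'i by apply/eqP; rewrite eq_complex /= oppr0 !eqxx.
  ring.
have : 'i * B x y *+ 2 = 0.
  have -> : 'i * B x y *+ 2 = 'i * (B x y + B y x) - (- 'i * B x y + 'i * B y x) by ring.
  by rewrite BD BI mulr0 subrr.
move=> /eqP; rewrite mulrn_eq0 /= mulf_eq0 => /orP[|].
  by rewrite eq_complex /= oner_eq0 andbF.
by rewrite subr_eq0 => /eqP.
Qed.

Lemma rdot_selfadjoint A x y : selfadjoint A -> rdot dot (A x) y = rdot dot x (A y).
Proof. by move=> sA; rewrite /rdot sA. Qed.

End Representation.

(** * Polynomials in an operator *)

Section PolyEval.
Variables (R : realType) (H : completeNormedModType R[i]).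
Implicit Types (x y : H) (A : H -> H) (p q : {poly R[i]}).

(** Complex coefficients, since the norm bound factors real polynomials over the
    complex numbers. *)
Definition peval p A x : H := \sum_(i < size p) p`_i *: iter i A x.

Lemma peval_widen n p A x : (size p <= n)%N ->
  peval p A x = \sum_(i < n) p`_i *: iter i A x.
Proof.
move=> pn; rewrite /peval (big_ord_widen n (fun i : nat => p`_i *: iter i A x) pn).
rewrite big_mkcond; apply: eq_bigr => i _.
by case: ltnP => // h; rewrite nth_default // scale0r.
Qed.

Lemma pevalD p q A x : peval (p + q) A x = peval p A x + peval q A x.
Proof.
set n := maxn (size p) (size q).
rewrite (@peval_widen n) ?size_polyD // (@peval_widen n p) ?leq_maxl //.
rewrite (@peval_widen n q) ?leq_maxr // -big_split; apply: eq_bigr => i _ /=.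
by rewrite coefD scalerDl.
Qed.

Lemma pevalZ a p A x : peval (a *: p) A x = a *: peval p A x.
Proof.
rewrite (@peval_widen (size p)) ?size_scale_leq // scaler_sumr.
by apply: eq_bigr => i _; rewrite coefZ scalerA.
Qed.

Lemma pevalC c A x : peval c%:P A x = c *: x.
Proof.
rewrite (@peval_widen 1) ?size_polyC_leq1 // big_ord1 coefC /=.
by [].
Qed.

Lemma pevalMX p A x : peval (p * 'X) A x = peval p A (A x).
Proof.
have sp : (size (p * 'X)%R <= (size p).+1)%N.
  by rewrite (leq_trans (size_polyMleq _ _)) // size_polyX addnC.
rewrite (@peval_widen _ _ A x sp) big_ord_recl coefMX /= scale0r add0r.
by apply: eq_bigr => i _; rewrite coefMX /= -iterSr.
Qed.

Lemma pevalX A x : peval 'X A x = A x.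
Proof. by rewrite -['X]mul1r pevalMX pevalC scale1r. Qed.

Section Linear.
Variable A : H -> H.
Hypothesis linA : linear A.

Lemma peval_comm p x : peval p A (A x) = A (peval p A x).
Proof.
rewrite linf_sum //; apply: eq_bigr => i _.
by rewrite linfZ // -iterSr.
Qed.

Lemma pevalM p q x : peval (p * q) A x = peval p A (peval q A x).
Proof.
elim/poly_ind: p q x => [|p c IH] q x.
  by rewrite mul0r /peval size_poly0 !big_ord0.
rewrite mulrDl !pevalD -mulrA ['X * q]mulrC IH !pevalMX peval_comm.
by rewrite mul_polyC pevalZ pevalC.
Qed.

End Linear.

Lemma bounded_iter A i : bounded_op A -> bounded_op (iter i A).
Proof. by move=> bA; elim: i => [|i IH] /=; [exact: bounded_id|exact: bounded_comp]. Qed.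

End PolyEval.

Section PolyOp.
Variables (R : realType) (H : completeNormedModType R[i]).
Implicit Types (x y : H) (A : H -> H) (p q : {poly R}).
Local Notation C p := (map_poly (real_complex R) p).

Lemma poly_opE p A x : poly_op p A x = peval (C p) A x.
Proof.
rewrite /peval /poly_op size_map_poly.
by apply: eq_bigr => i _; rewrite coef_map.
Qed.

Lemma poly_opD p q A x : poly_op (p + q) A x = poly_op p A x + poly_op q A x.
Proof. by rewrite !poly_opE rmorphD pevalD. Qed.

Lemma poly_opN p A x : poly_op (- p) A x = - poly_op p A x.
Proof. by rewrite -scaleN1r -mul_polyC !poly_opE rmorphM /= map_polyC /= mul_polyC pevalZ rmorphN1 scaleN1r. Qed.

Lemma poly_opB p q A x : poly_op (p - q) A x = poly_op p A x - poly_op q A x.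
Proof. by rewrite poly_opD poly_opN. Qed.

Lemma poly_opC c A x : poly_op c%:P A x = c%:C *: x.
Proof. by rewrite poly_opE map_polyC pevalC. Qed.

Lemma poly_opX A x : poly_op 'X A x = A x.
Proof. by rewrite poly_opE map_polyX pevalX. Qed.

Lemma poly_opM p q A x : linear A ->
  poly_op (p * q) A x = poly_op p A (poly_op q A x).
Proof. by move=> lA; rewrite !poly_opE rmorphM /= pevalM. Qed.

Lemma bounded_poly_op p A : bounded_op A -> bounded_op (poly_op p A).
Proof.
by move=> bA; apply: bounded_sum => i; apply: bounded_scale; exact: bounded_iter.
Qed.

Variable dot : {dot H for Num.conj}.

Lemma selfadjoint_iter A i : selfadjoint dot A -> selfadjoint dot (iter i A).
Proof. by move=> sA; elim: i => //= i IH x y; rewrite sA IH -iterSr. Qed.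

Lemma selfadjoint_poly_op p A : selfadjoint dot A -> selfadjoint dot (poly_op p A).
Proof.
move=> sA x y; rewrite /poly_op dot_suml dot_sumr; apply: eq_bigr => i _.
by rewrite dotZl dotZr conj_real (selfadjoint_iter _ sA).
Qed.

End PolyOp.

(** * Norm bound for polynomials in a positive operator *)

Section SpectralBound.
Variables (R : realType) (H : completeNormedModType R[i]).
Variable dot : {dot H for Num.conj}.
Hypothesis dot_norm : forall x : H, dot x x = `|x| ^+ 2.
Implicit Types (x y : H) (p : {poly R}).

Lemma selfadjoint_dot_real A x : selfadjoint dot A -> dot (A x) x = (rdot dot (A x) x)%:C.
Proof.
move=> sA; rewrite /rdot RRe_real //; apply/CrealP.
by rewrite -dotC sA.
Qed.

Lemma Cabs_le_Re_Im (z : H) x (c : R) : 0 <= c ->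
  c * rnorm x ^+ 2 <= `|Re (dot z x)| \/ c * rnorm x ^+ 2 <= `|Im (dot z x)| ->
  c * rnorm x <= rnorm z.
Proof.
move=> c0 h; have [->|x0] := eqVneq x 0; first by rewrite rnorm0 mulr0 rnorm_ge0.
have nx : 0 < rnorm x by rewrite lt_neqAle rnorm_ge0 eq_sym rnorm_eq0 x0.
rewrite -(ler_pM2r nx) -mulrA -expr2.
case: h => h; apply: le_trans h _; first exact: rdot_le.
have -> : Im (dot z x) = rdot dot z ('i *: x).
  rewrite /rdot dotZr.
  have -> : Num.conj ('i : R[i]) = - 'i by apply/eqP; rewrite eq_complex /= oppr0 !eqxx.
  by case: (dot z x) => a b /=; ring.
apply: le_trans (rdot_le dot_norm _ _) _.
rewrite rnormZ (_ : Re `|'i| = 1) ?mul1r //.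
by rewrite normc_def /= expr0n /= add0r expr1n sqrtr1.
Qed.

Definition bounded_below (B : H -> H) :=
  exists2 c : R, 0 < c & forall x, c * rnorm x <= rnorm (B x).

Section Positive.
Variable A : H -> H.
Hypothesis posA : positive_op dot A.
Let M := opnorm A.

Let bA : bounded_op A. Proof. by case: posA. Qed.
Let lA : linear A. Proof. by case: bA. Qed.
Let sA : selfadjoint dot A. Proof. exact: positive_selfadjoint. Qed.

Lemma positive_form_bounds x : 0 <= rdot dot (A x) x <= M * rnorm x ^+ 2.
Proof.
apply/andP; split.
  by have [_ /(_ x)] := posA; rewrite lecE => /andP[].
apply: le_trans (ler_norm _) _; apply: le_trans (rdot_le dot_norm _ _) _.
by rewrite expr2 mulrA ler_wpM2r ?rnorm_ge0 ?opnorm_ub.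
Qed.

(** [<(A - z) x, x> = |x|^2 (w - z)] for some [w] in [[0, ||A||]]. Its imaginary part
    is bounded below when [z] is not real, its real part when [z] is real and off
    that interval. *)
Lemma resolvent_bounded_below (z : R[i]) :
  (Im z = 0 -> Re z < 0 \/ M < Re z) -> bounded_below (fun x => A x - z *: x).
Proof.
case: z => a b /= hz.
have E x : dot (A x - (a +i* b) *: x) x =
    (rdot dot (A x) x - a * rnorm x ^+ 2) +i* (- (b * rnorm x ^+ 2)).
  rewrite dotBl dotZl (selfadjoint_dot_real _ sA) (dot_rnorm dot_norm).
  by apply/eqP; rewrite eq_complex /=; apply/andP; split; apply/eqP; ring.
have [b0|b0] := eqVneq b 0; last first.
  exists `|b|; first by rewrite normr_gt0.
  move=> x; apply: Cabs_le_Re_Im => //; right.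
  by rewrite E /= normrN normrM (ger0_norm (sqr_ge0 _)).
have nn x := sqr_ge0 (rnorm x).
have [a0|aM] := hz b0.
  exists (- a) => [|x]; first by rewrite oppr_gt0.
  apply: Cabs_le_Re_Im; first by rewrite oppr_ge0 ltW.
  left; rewrite E /=; apply: le_trans (ler_norm _).
  have /andP[+ _] := positive_form_bounds x; lra.
exists (a - M) => [|x]; first by rewrite subr_gt0.
apply: Cabs_le_Re_Im; first by rewrite subr_ge0 ltW.
left; rewrite E /= distrC; apply: le_trans (ler_norm _).
have /andP[_] := positive_form_bounds x; lra.
Qed.

(** The linear factors of [q] are bounded below, and so is their composite. *)
Lemma peval_bounded_below (q : {poly R[i]}) : q != 0 ->
  (forall s : R, 0 <= s <= M -> q.[s%:C] != 0) -> bounded_below (peval q A).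
Proof.
have [rs {1 2 3}->] := closed_field_poly_normal q.
rewrite scaler_eq0 negb_or lead_coef_eq0 => /andP[q0 _].
set a := lead_coef q => hq.
have a0 : a != 0 by rewrite lead_coef_eq0.
have na : 0 < Re `|a| by have := normr_gt0 a; rewrite a0 ltcE /= => /andP[_].
suff [c c0 hc] : bounded_below (peval (\prod_(z <- rs) ('X - z%:P)) A).
  exists (Re `|a| * c); first exact: mulr_gt0.
  by move=> x; rewrite pevalZ rnormZ -mulrA ler_wpM2l // ltW.
have {}hq s z : 0 <= s <= M -> z \in rs -> s%:C != z.
  move=> /hq + zrs; apply: contra => /eqP ->.
  by rewrite hornerZ mulf_eq0 -rootE root_prod_XsubC zrs orbT.
elim: rs hq {q q0 a a0 na} => [|z rs IH] hq.
  exists 1 => // x; by rewrite big_nil pevalC scale1r mul1r.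
have [|c c0 hc] := IH; first by move=> s w sM wrs; apply: hq; rewrite // inE wrs orbT.
have [|d d0 hd] := @resolvent_bounded_below z.
  move=> z0; have [h|h] := ltP (Re z) 0; first by left.
  right; rewrite ltNge; apply/negP => h'.
  have := hq (Re z) z; rewrite h h' mem_head => /(_ isT isT)/eqP; apply.
  by apply/eqP; rewrite eq_complex /= z0 !eqxx.
exists (d * c) => [|x]; first exact: mulr_gt0.
rewrite big_cons pevalM // -polyCN pevalD pevalC.
rewrite pevalX scaleNr.
by apply: (le_trans _ (hd _)); rewrite -mulrA ler_wpM2l ?hc // ltW.
Qed.

(** Suppose [mu = ||p(A)|| > c]. Then [q = p^2 - mu^2] has no zero on [[0, ||A||]],
    so [q(A)] is bounded below. But [|q(A) x|] is small at unit vectors [x] where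
    [|p(A) x|] is close to [mu]. *)
Lemma poly_op_norm_le p (c : R) : (forall s, 0 <= s <= M -> `|p.[s]| <= c) ->
  forall x, rnorm (poly_op p A x) <= c * rnorm x.
Proof.
move=> hp; have c0 : 0 <= c.
  by apply: le_trans (hp 0 _); rewrite ?normr_ge0 // lexx opnorm_ge0.
set K := poly_op p A; have bK : bounded_op K by exact: bounded_poly_op.
suff hK : opnorm K <= c.
  by move=> x; apply: le_trans (opnorm_ub _ bK) _; rewrite ler_wpM2r ?rnorm_ge0.
rewrite leNgt; apply/negP; set mu := opnorm K => cmu.
have mu0 : 0 < mu by exact: le_lt_trans cmu.
pose q : {poly R} := p ^+ 2 - (mu ^+ 2)%:P.
have q_neg s : 0 <= s <= M -> q.[s] < 0.
  move=> sM; rewrite /q hornerD hornerN hornerC horner_exp subr_lt0.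
  rewrite -real_normK ?num_real // ltr_pXn2r ?nnegrE ?normr_ge0 ?(ltW mu0) //.
  exact: le_lt_trans (hp _ sM) cmu.
have qE x : poly_op q A x = K (K x) - (mu ^+ 2)%:C *: x.
  by rewrite poly_opB expr2 poly_opM // poly_opC.
have [||d d0 hd] := @peval_bounded_below (map_poly (real_complex R) q).
- rewrite map_poly_eq0; apply/eqP => q0.
  by have := q_neg 0; rewrite lexx opnorm_ge0 q0 horner0 ltxx => /(_ isT).
- by move=> s /q_neg sq; rewrite horner_map fmorph_eq0 lt_eqF.
have sK : selfadjoint dot K by exact: selfadjoint_poly_op.
(* [K^2 x] and [mu^2 x] are far apart, which keeps [K x] away from norm [mu] *)
have Kx_le x : rnorm (K x) ^+ 2 <= (mu ^+ 2 - d ^+ 2 / mu ^+ 2) * rnorm x ^+ 2.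
  have := hd x; rewrite -poly_opE qE.
  have dx0 : 0 <= d * rnorm x by rewrite mulr_ge0 ?rnorm_ge0 // ltW.
  rewrite -(@ler_pXn2r _ 2) ?nnegrE ?rnorm_ge0 // (rnorm_sqB dot_norm) rdotZr.
  rewrite (rdot_selfadjoint _ _ sK) (rdotxx dot_norm) rnormZr !exprMn.
  rewrite real_normK ?num_real //.
  have : rnorm (K (K x)) ^+ 2 <= mu ^+ 2 * rnorm (K x) ^+ 2.
    rewrite -exprMn ler_pXn2r ?nnegrE ?mulr_ge0 ?rnorm_ge0 ?(ltW mu0) //.
    exact: opnorm_ub.
  set k := rnorm (K x) ^+ 2; set n := rnorm x ^+ 2 => h1 h2.
  have m2 : 0 < mu ^+ 2 by exact: exprn_gt0.
  rewrite -(ler_pM2l m2).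
  have -> : mu ^+ 2 * ((mu ^+ 2 - d ^+ 2 / mu ^+ 2) * n) = (mu ^+ 2) ^+ 2 * n - d ^+ 2 * n.
    by field; rewrite gt_eqF.
  lra.
set r := mu ^+ 2 - d ^+ 2 / mu ^+ 2 in Kx_le.
have rmu : r < mu ^+ 2 by rewrite ltrBlDr ltrDl divr_gt0 ?exprn_gt0.
pose r0 := Num.max r 0.
have r00 : 0 <= r0 by rewrite le_max lexx orbT.
have : mu <= Num.sqrt r0.
  apply: opnorm_le => [|x]; first exact: sqrtr_ge0.
  rewrite -(@ler_pXn2r _ 2) ?nnegrE ?mulr_ge0 ?rnorm_ge0 ?sqrtr_ge0 //.
  rewrite exprMn sqr_sqrtr //; apply: le_trans (Kx_le x) _.
  by rewrite ler_wpM2r ?sqr_ge0 // le_max lexx.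
rewrite -(@ler_pXn2r _ 2) ?nnegrE ?sqrtr_ge0 ?(ltW mu0) // sqr_sqrtr //.
by rewrite leNgt gt_max rmu exprn_gt0.
Qed.

End Positive.
End SpectralBound.

(** * Polynomial approximation of real powers *)

Section Approximation.
Variable R : realType.
Implicit Types (f g h : R -> R) (c s t u x y M : R) (n k : nat).

Section Bernstein.
Variable c : R.

(** Bernstein polynomial of degree [n] in the variable [c * s]: the expectation of
    [g] at a binomial variable, computed by conditioning on the first trial. This
    recursion makes monotonicity and the second moment plain inductions. *)
Fixpoint bernstein n (g : nat -> R) : {poly R} :=
  if n is m.+1 then
    (c *: 'X) * bernstein m (g \o S) + (1 - c *: 'X) * bernstein m g
  else (g 0%N)%:P.

Lemma bernsteinS n (g : nat -> R) s : (bernstein n.+1 g).[s] =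
  c * s * (bernstein n (g \o S)).[s] + (1 - c * s) * (bernstein n g).[s].
Proof. by rewrite /= !hornerE. Qed.

Lemma eq_bernstein n (g h : nat -> R) : g =1 h -> bernstein n g = bernstein n h.
Proof. by move=> /funext ->. Qed.

Lemma bernstein_le n (g h : nat -> R) s : 0 <= c * s <= 1 ->
  (forall k, (k <= n)%N -> g k <= h k) -> (bernstein n g).[s] <= (bernstein n h).[s].
Proof.
move=> cs; have /andP[cs0 cs1] := cs.
elim: n g h => [|n IH] g h gh; first by rewrite !hornerC gh.
rewrite !bernsteinS lerD // ler_wpM2l ?subr_ge0 // IH // => k kn; apply: gh => //.
exact: leqW.
Qed.

Lemma bernstein_second_moment n (a b y s : R) :
  (bernstein n (fun k => a + b * (k%:R - y) ^+ 2)).[s] =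
  a + b * (n%:R * (c * s) * (1 - c * s) + (n%:R * (c * s) - y) ^+ 2).
Proof.
elim: n y => [|n IH] y; first by rewrite hornerC; ring.
rewrite bernsteinS IH.
rewrite (@eq_bernstein n _ (fun k => a + b * (k%:R - (y - 1)) ^+ 2)); last first.
  by move=> k /=; rewrite -natr1; ring.
by rewrite IH -natr1; ring.
Qed.

End Bernstein.

(** The modulus of continuity is quadratic because the Bernstein operator controls
    [(s - u)^2] by the binomial variance. Uniform continuity of a bounded [f] implies
    such a modulus. *)
Lemma polynomial_approximation f M : 0 < M ->
  (forall e, 0 < e -> exists2 K, 0 <= K & forall s u,
     0 <= s <= M -> 0 <= u <= M -> `|f s - f u| <= e + K * (s - u) ^+ 2) ->
  forall e, 0 < e -> exists p : {poly R}, forall s, 0 <= s <= M -> `|p.[s] - f s| <= e.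
Proof.
move=> M0 hf e e0; have e20 : 0 < e / 2 by rewrite divr_gt0.
have [K K0 hK] := hf _ e20.
pose n := (Num.truncn (K * M ^+ 2 / (e / 2))).+1.
have nK : K * M ^+ 2 / n%:R <= e / 2.
  rewrite ler_pdivrMr ?ltr0n // -ler_pdivrMl // mulrC ltW //.
  exact: truncnS_gt.
have n0 : n%:R != 0 :> R by rewrite pnatr_eq0.
have M0' : M != 0 by rewrite gt_eqF.
exists (bernstein M^-1 n (fun k => f (M * (k%:R / n%:R)))) => s sM.
have /andP[s0 s1] := sM.
have x01 : 0 <= M^-1 * s <= 1.
  by rewrite mulr_ge0 ?invr_ge0 ?(ltW M0) //= ler_pdivrMl // mulr1.
have /andP[x0 x1] := x01; set x := M^-1 * s in x0 x1.
have close k : (k <= n)%N -> `|f (M * (k%:R / n%:R)) - f s| <=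
    e / 2 + K * M ^+ 2 / n%:R ^+ 2 * (k%:R - n%:R * x) ^+ 2.
  move=> kn; have -> : K * M ^+ 2 / n%:R ^+ 2 * (k%:R - n%:R * x) ^+ 2 =
      K * (M * (k%:R / n%:R) - s) ^+ 2 by rewrite /x; field; rewrite n0.
  apply: hK => //; rewrite mulr_ge0 ?divr_ge0 ?(ltW M0) //=.
  by rewrite -[leRHS]mulr1 ler_wpM2l ?(ltW M0) // ler_pdivrMr ?ltr0n // mul1r ler_nat.
have tailB : K * M ^+ 2 / n%:R ^+ 2 *
    (n%:R * x * (1 - x) + (n%:R * x - n%:R * x) ^+ 2) <= e / 2.
  rewrite subrr expr0n /= addr0.
  have -> : K * M ^+ 2 / n%:R ^+ 2 * (n%:R * x * (1 - x)) =
    K * M ^+ 2 / n%:R * (x * (1 - x)) by field.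
  apply: le_trans nK; apply: ler_piMr; first by rewrite divr_ge0 ?ler0n // mulr_ge0 ?sqr_ge0.
  have := mulr_ge0 x0 x0; lra.
set B := K * M ^+ 2 / n%:R ^+ 2 in close tailB.
have lower : (bernstein M^-1 n (fun k => (f s - e / 2) + - B * (k%:R - n%:R * x) ^+ 2)).[s]
    <= (bernstein M^-1 n (fun k => f (M * (k%:R / n%:R)))).[s].
  apply: bernstein_le => // k /close; rewrite ler_norml => /andP[+ _].
  set v := _ ^+ 2; lra.
have upper : (bernstein M^-1 n (fun k => f (M * (k%:R / n%:R)))).[s] <=
    (bernstein M^-1 n (fun k => (f s + e / 2) + B * (k%:R - n%:R * x) ^+ 2)).[s].
  apply: bernstein_le => // k /close; rewrite ler_norml => /andP[_].
  set v := _ ^+ 2; lra.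
move: lower upper; rewrite !bernstein_second_moment -/x ler_norml.
by move=> lower upper; apply/andP; split; lra.
Qed.

Lemma powR_subadditive t u s : 0 <= t <= 1 -> 0 <= u -> 0 <= s ->
  (u + s) `^ t <= u `^ t + s `^ t.
Proof.
move=> /andP[t0 t1] u0 s0.
have [us0|us0] := eqVneq (u + s) 0.
  have /eqP : u = 0 by lra.
  have /eqP : s = 0 by lra.
  by move=> /eqP -> /eqP ->; rewrite addr0 lerDl powR_ge0.
have us : 0 < u + s by rewrite lt_neqAle eq_sym us0 addr_ge0.
have le_powR w : 0 <= w -> w <= u + s -> w / (u + s) <= (w / (u + s)) `^ t.
  rewrite le_eqVlt => /predU1P[<-|w0] wus; first by rewrite mul0r powR_ge0.
  by apply: ger1_powR => //; rewrite divr_gt0 //= ler_pdivrMr // mul1r.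
have hu := le_powR u u0; have hs := le_powR s s0.
have -> : u `^ t = (u + s) `^ t * (u / (u + s)) `^ t.
  by rewrite -powRM ?divr_ge0 ?(ltW us) // mulrCA divff // mulr1.
have -> : s `^ t = (u + s) `^ t * (s / (u + s)) `^ t.
  by rewrite -powRM ?divr_ge0 ?(ltW us) // mulrCA divff // mulr1.
rewrite -mulrDr -[leLHS]mulr1 ler_wpM2l ?powR_ge0 //.
rewrite -(divff us0) mulrDl lerD ?hu ?hs ?lerDl ?lerDr //.
Qed.

Lemma powR_holder t s u : 0 <= t <= 1 -> 0 <= s -> 0 <= u ->
  `|s `^ t - u `^ t| <= `|s - u| `^ t.
Proof.
move=> t01 s0 u0; wlog us : s u s0 u0 / u <= s => [hw|].
  have [us|us] := leP u s; first exact: hw.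
  by rewrite distrC [`|s - u|]distrC hw // ltW.
have /andP[t0 _] := t01.
rewrite !ger0_norm ?subr_ge0 ?ge0_ler_powR ?nnegrE //.
have := powR_subadditive t01 u0 (_ : 0 <= s - u); rewrite subr_ge0 => /(_ us).
by rewrite addrC subrK; lra.
Qed.

(** Exponents below 1 give no derivative at 0, so the modulus of continuity comes
    from the Hoelder estimate: points closer than [d^(1/t)] have powers within [d],
    and for the others [(s - u)^2 / r^2 >= 1]. *)
Lemma powR_polynomial_approximation t M e : 0 <= t <= 1 -> 0 <= M -> 0 < e ->
  exists p : {poly R}, forall s, 0 <= s <= M -> `|p.[s] - s `^ t| <= e.
Proof.
move=> t01 M0 e0; have /andP[t0 t1] := t01.
have [tE|tN0] := eqVneq t 0.
  by exists 1 => s _; rewrite tE powRr0 hornerC subrr normr0 ltW.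
have {}t0 : 0 < t by rewrite lt_neqAle eq_sym tN0.
have M1 : 0 < M + 1 by rewrite ltr_wpDl.
have [|p hp] := @polynomial_approximation (fun s => s `^ t) (M + 1) M1 _ e e0.
  move=> d d0; pose r := d `^ t^-1.
  have r0 : 0 < r by exact: powR_gt0.
  exists ((M + 1) `^ t / r ^+ 2) => [|s u /andP[s0 sM] /andP[u0 uM]].
    by rewrite divr_ge0 ?powR_ge0 ?sqr_ge0.
  have [sur|sur] := leP `|s - u| r.
    apply: le_trans (powR_holder t01 s0 u0) _.
    have -> : d = r `^ t by rewrite /r -powRrM mulVf // powRr1 // ltW.
    have K0 : 0 <= (M + 1) `^ t / r ^+ 2 by rewrite divr_ge0 ?powR_ge0 ?sqr_ge0.
    rewrite -[leLHS]addr0; apply: lerD; last exact: mulr_ge0 (sqr_ge0 _).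
    by rewrite ge0_ler_powR ?nnegrE ?(ltW t0) ?(ltW r0).
  have : `|s `^ t - u `^ t| <= (M + 1) `^ t.
    have sM' : s `^ t <= (M + 1) `^ t by rewrite ge0_ler_powR ?nnegrE ?(ltW t0) ?(ltW M1).
    have uM' : u `^ t <= (M + 1) `^ t by rewrite ge0_ler_powR ?nnegrE ?(ltW t0) ?(ltW M1).
    have := powR_ge0 s t; have := powR_ge0 u t.
    by move=> ? ?; rewrite ler_norml; apply/andP; split; lra.
  move=> h; apply: (le_trans h); rewrite -[leLHS]add0r lerD ?(ltW d0) //.
  rewrite -mulrA ler_peMr ?powR_ge0 // mulrC ler_pdivlMr ?exprn_gt0 // mul1r.
  by rewrite -(real_normK (num_real (s - u))) ler_pXn2r ?nnegrE ?(ltW r0) ?(ltW sur).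
by exists p => s /andP[s0 sM]; apply: hp; rewrite s0 (le_trans sM) ?lerDl.
Qed.

End Approximation.

(** * Continuous functional calculus of a positive operator *)

Section UniformApproximation.
Variable R : realType.
Implicit Types (f g : R -> R) (p q : {poly R}) (M e : R).

Lemma half_pos e : 0 < e -> 0 < e / 2.
Proof. by move=> e0; rewrite divr_gt0. Qed.

Lemma exists_small_factor (n e : R) : 0 <= n -> 0 < e ->
  exists2 d, 0 < d & d * n <= e.
Proof.
move=> n0 e0; have n1 : 0 < n + 1 by rewrite ltr_wpDl.
exists (e / (n + 1)); first by rewrite divr_gt0.
by rewrite mulrAC ler_pdivrMr // ler_wpM2l ?(ltW e0) // lerDl.
Qed.

Definition poly_close M f e p := forall s, 0 <= s <= M -> `|p.[s] - f s| <= e.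

Lemma uniform_cvg_poly_close M f (p : nat -> {poly R}) :
  {uniform `[0, M], (fun n (s : R) => (p n).[s]) @ \oo --> f} <->
  forall e, 0 < e -> \forall n \near \oo, poly_close M f e (p n).
Proof.
split=> [pf e e0|pf].
  pose U := [set h : R -> R | forall s, s \in `[0, M] -> `|h s - f s| <= e].
  suff : nbhs (f : {uniform` `[0, M] -> R}) U.
    move=> /pf; rewrite /nbhs /=; apply: filterS => n hn s sM.
    by apply: hn; rewrite in_itv.
  apply/uniform_nbhs; exists [set uv | ball uv.1 e uv.2]; split.
    by rewrite -entourage_ballE; exists e.
  move=> h /= hh s sM; rewrite distrC; apply: ltW.
  by have := hh s; rewrite -ball_normE /=; apply; rewrite inE in sM *.
move=> U /uniform_nbhs[E [entE EU]].
have [e /= e0 he] : exists2 e : R, 0 < e & [set uv | ball uv.1 e uv.2] `<=` E.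
  by move: entE; rewrite -entourage_ballE => -[e e0 he]; exists e.
have e20 : 0 < e / 2 by rewrite divr_gt0.
rewrite /nbhs /=; near=> n; apply: EU => s /= sM; apply: he.
rewrite -ball_normE /= distrC.
have /le_lt_trans-> // : `|(p n).[s] - f s| <= e / 2; last by lra.
have : poly_close M f (e / 2) (p n) by near: n; exact: pf.
by apply; move: sM; rewrite in_itv.
Unshelve. all: by end_near.
Qed.

End UniformApproximation.

Section FunctionalCalculus.
Variables (R : realType) (H : completeNormedModType R[i]).
Variable dot : {dot H for Num.conj}.
Hypothesis dot_norm : forall x : H, dot x x = `|x| ^+ 2.
Variable A : H -> H.
Hypothesis posA : positive_op dot A.
Implicit Types (f g : R -> R) (p q : {poly R}) (e : R) (x y : H) (B C : H -> H).
Let M := opnorm A.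

Let bA : bounded_op A. Proof. by case: posA. Qed.
Let lA : linear A. Proof. by case: bA. Qed.
Let sA : selfadjoint dot A. Proof. exact: positive_selfadjoint. Qed.

Lemma poly_op_close f p q e e' x : poly_close M f e p -> poly_close M f e' q ->
  rnorm (poly_op p A x - poly_op q A x) <= (e + e') * rnorm x.
Proof.
move=> hp hq; rewrite -poly_opB; apply: (poly_op_norm_le dot_norm posA) => s sM.
rewrite hornerD hornerN.
have -> : p.[s] - q.[s] = (p.[s] - f s) - (q.[s] - f s) by ring.
by apply: le_trans (ler_normB _ _) _; rewrite lerD ?hp ?hq.
Qed.

(** [B] is compared with all polynomials close to [f], and not only with one
    sequence. This is what gives uniqueness and products at once; the two forms
    agree because of the norm bound for polynomials. *)
Definition fun_calc f B :=
  bounded_op B /\ forall e p x, 0 < e -> poly_close M f e p ->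
    rnorm (poly_op p A x - B x) <= e * rnorm x.

Definition poly_approximable f := forall e, 0 < e -> exists p, poly_close M f e p.

Lemma is_fun_calcP f B : is_fun_calc f A B <-> poly_approximable f /\ fun_calc f B.
Proof.
split=> [[bB [p [/uniform_cvg_poly_close pf pB]]]|[af [bB hB]]].
  split=> [e /pf [N _ hN]|]; first by exists (p N); exact: (hN N (leqnn N)).
  split=> // e q x e0 qf; apply/ler_addgt0Pr => d d0.
  have [d' d'0 h5] := exists_small_factor (rnorm_ge0 x) (half_pos d0).
  have [N _ hN] := pf _ d'0; have pN := hN N.
  have /cvgrPdist_lt/(_ _ d'0)[N' _ hN'] := pB.
  pose n := maxn N N'.
  have h1 := poly_op_close x qf (hN n (leq_maxl _ _)).
  have := hN' n (leq_maxr _ _); rewrite /= sub0r normrN ger0_norm ?opnorm_ge0 // => h2.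
  have h3 : rnorm (poly_op (p n) A x - B x) <= d' * rnorm x.
    apply: le_trans (@opnorm_ub _ _ (fun y => poly_op (p n) A y - B y) x _) _.
      rewrite (_ : (fun y => _) = (fun y => poly_op (p n) A y + (-1) *: B y)).
        by apply: bounded_add; [exact: bounded_poly_op|exact: bounded_scale].
      by apply/funext => y; rewrite scaleN1r.
    by rewrite ler_wpM2r ?rnorm_ge0 // ltW.
  have h4 := rdist_triangle (poly_op q A x) (poly_op (p n) A x) (B x).
  move: h1; rewrite mulrDl; lra.
split=> //.
have invS0 n : 0 < n.+1%:R^-1 :> R by rewrite invr_gt0.
have /choice[p hp] n : exists p, poly_close M f n.+1%:R^-1 p by exact: af.
exists p; split.
  apply/uniform_cvg_poly_close => e e0.
  have := near_infty_natSinv_lt (PosNum e0); apply: filterS => n /= hn s sM.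
  exact: le_trans (hp n s sM) (ltW hn).
apply/cvgrPdist_lt => e e0.
have := near_infty_natSinv_lt (PosNum e0); apply: filterS => n /= hn.
rewrite sub0r normrN ger0_norm ?opnorm_ge0 //; apply: le_lt_trans hn.
by apply: opnorm_le => [|x]; [exact: ltW|exact: hB].
Qed.

(** By the norm bound, the values [p(A) x] at polynomials [p] close to [f] form a
    Cauchy family for each [x]. *)
Lemma fun_calc_exists f : poly_approximable f -> exists B, is_fun_calc f A B.
Proof.
move=> af.
have /choice[B hB] x : exists y, forall p e, 0 < e -> poly_close M f e p ->
    rnorm (poly_op p A x - y) <= e * rnorm x.
  pose E e := [set w | exists p d, [/\ w = poly_op p A x, 0 < d,
    poly_close M f d p & d * rnorm x <= e]].
  have [|e e' w w' [p [d [-> d0 pf de]]] [p' [d' [-> d'0 pf' de']]]|y hy] := @complete_approx R H E.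
  - move=> e /(exists_small_factor (rnorm_ge0 x))[d d0 de].
    by have [p pf] := af _ d0; exists (poly_op p A x); exists p, d.
  - apply: le_trans (poly_op_close x pf pf') _.
    by rewrite mulrDl lerD.
  exists y => p e e0 pf; apply/ler_addgt0Pr => d d0; apply: hy.
    by rewrite ltr_wpDl // mulr_ge0 ?rnorm_ge0 // ltW.
  by exists p, e; split=> //; rewrite lerDl ltW.
have lB : linear B.
  move=> a x y; apply/eqP; rewrite -subr_eq0 -rnorm_eq0; apply/eqP.
  apply: (@eq0_small _ _ (rnorm (a *: x + y) + (Re `|a| * rnorm x + rnorm y))).
    have a0 := Re_norm_ge0 a.
    by rewrite !addr_ge0 ?mulr_ge0 ?rnorm_ge0.
  move=> e e0; have [p pf] := af _ e0.
  have h1 := hB (a *: x + y) _ _ e0 pf; have h2 := hB x _ _ e0 pf.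
  have h3 := hB y _ _ e0 pf.
  have lp : linear (poly_op p A) by exact/bounded_op_linear/bounded_poly_op.
  have -> : B (a *: x + y) - (a *: B x + B y) =
      (a *: (poly_op p A x - B x) + (poly_op p A y - B y))
      - (poly_op p A (a *: x + y) - B (a *: x + y)).
    by rewrite lp scalerBr addrACA -opprD opprB [RHS]addrC addrA subrK.
  rewrite ger0_norm ?rnorm_ge0 //; apply: le_trans (rnormB _ _) _.
  have := rnormD (a *: (poly_op p A x - B x)) (poly_op p A y - B y).
  rewrite rnormZ.
  have a0 := Re_norm_ge0 a.
  have := ler_wpM2l a0 h2; lra.
exists B; apply/is_fun_calcP; split=> //; split=> [|e p x e0 pf]; last exact: hB.
have [p pf] := af 1 ltr01.
apply: (@bounded_opI _ _ _ (opnorm (poly_op p A) + 1)) => // x.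
have h1 := hB x _ _ ltr01 pf.
have h2 := @opnorm_ub _ _ (poly_op p A) x (bounded_poly_op p bA).
have := rdist_triangle (B x) (poly_op p A x) 0; rewrite !subr0 rdistC mulrDl.
lra.
Qed.

Lemma fun_calc_unique f g B C : (forall s, 0 <= s <= M -> f s = g s) ->
  is_fun_calc f A B -> is_fun_calc g A C -> forall x, B x = C x.
Proof.
move=> fg /is_fun_calcP[af [_ hB]] /is_fun_calcP[_ [_ hC]] x.
apply/eqP; rewrite -subr_eq0 -rnorm_eq0; apply/eqP.
apply: (@eq0_small _ _ (rnorm x *+ 2)); first by rewrite mulrn_wge0 ?rnorm_ge0.
move=> e e0; have [p pf] := af _ e0; have h1 := hB _ _ x e0 pf.
have h2 : rnorm (poly_op p A x - C x) <= e * rnorm x.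
  by apply: hC => // s sM; rewrite -fg // pf.
rewrite ger0_norm ?rnorm_ge0 //.
apply: le_trans (rdist_triangle _ (poly_op p A x) _) _; rewrite rdistC; lra.
Qed.

Lemma fun_calc_poly p : is_fun_calc (fun s => p.[s]) A (poly_op p A).
Proof.
apply/is_fun_calcP; split; first by move=> e e0; exists p => s _; rewrite subrr normr0 ltW.
split=> [|e q x e0 qf]; first exact: bounded_poly_op.
rewrite -poly_opB; apply: (poly_op_norm_le dot_norm posA) => s sM.
by rewrite hornerD hornerN; exact: qf.
Qed.

Lemma fun_calc_norm_le f B (c : R) : is_fun_calc f A B ->
  (forall s, 0 <= s <= M -> `|f s| <= c) -> forall x, rnorm (B x) <= c * rnorm x.
Proof.
move=> /is_fun_calcP[af [_ hB]] fc x; apply/ler_addgt0Pr => d d0.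
have [e e0 h5] := exists_small_factor (rnorm_ge0 x) (half_pos d0).
have [p pf] := af _ e0; have h1 := hB _ _ x e0 pf.
have h2 : rnorm (poly_op p A x) <= (c + e) * rnorm x.
  apply: (poly_op_norm_le dot_norm posA) => s sM.
  rewrite -[p.[s]](subrK (f s)) addrC; apply: le_trans (ler_normD _ _) _.
  by rewrite lerD ?fc ?pf.
have := rdist_triangle (B x) (poly_op p A x) 0; rewrite !subr0 rdistC.
move: h2; rewrite mulrDl; lra.
Qed.

Lemma fun_calc_selfadjoint f B : is_fun_calc f A B -> selfadjoint dot B.
Proof.
move=> /is_fun_calcP[af [bB hB]].
have lB := bounded_op_linear bB.
have rB x y : rdot dot (B x) y = rdot dot x (B y).
  apply/eqP; rewrite -subr_eq0; apply/eqP.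
  apply: (@eq0_small _ _ (rnorm x * rnorm y *+ 2)).
    by rewrite mulrn_wge0 ?mulr_ge0 ?rnorm_ge0.
  move=> e e0; have [p pf] := af _ e0.
  have h1 := hB _ _ x e0 pf; have h2 := hB _ _ y e0 pf.
  have -> : rdot dot (B x) y - rdot dot x (B y) =
      rdot dot x (poly_op p A y - B y) - rdot dot (poly_op p A x - B x) y.
    rewrite !rdotE (rdot_selfadjoint _ _ (selfadjoint_poly_op p sA)); ring.
  apply: le_trans (ler_normB _ _) _; rewrite mulr2n mulrDl; apply: lerD.
    apply: le_trans (rdot_le dot_norm _ _) _.
    by rewrite -mulrA ler_wpM2l ?rnorm_ge0 // mulrC.
  apply: le_trans (rdot_le dot_norm _ _) _.
  by rewrite mulrAC ler_wpM2r ?rnorm_ge0 // mulrC.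
by move=> x y; apply: dot_Re_eq => a; rewrite -linfZ // rB.
Qed.

Lemma fun_calcM f g B C (c : R) :
  (forall s, 0 <= s <= M -> `|f s| <= c) -> (forall s, 0 <= s <= M -> `|g s| <= c) ->
  is_fun_calc f A B -> is_fun_calc g A C ->
  is_fun_calc (fun s => f s * g s) A (fun x => B (C x)).
Proof.
move=> fc gc hB hC.
have cB := fun_calc_norm_le hB fc; have cC := fun_calc_norm_le hC gc.
have c0 : 0 <= c by apply: le_trans (fc 0 _); rewrite ?normr_ge0 // lexx opnorm_ge0.
have /is_fun_calcP[af [bB {}hB]] := hB; have /is_fun_calcP[ag [bC {}hC]] := hC.
have lB := bounded_op_linear bB; have lC := bounded_op_linear bC.
have close e : 0 < e -> exists p q d, [/\ 0 < d <= 1, d * (c *+ 2 + 1) <= e,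
    poly_close M f d p, poly_close M g d q & poly_close M (fun s => f s * g s) e (p * q)].
  move=> e0; have c1 : 0 < c *+ 2 + 1 by rewrite ltr_wpDl // mulrn_wge0.
  pose d := Num.min 1 (e / (c *+ 2 + 1)).
  have d0 : 0 < d by rewrite lt_min ltr01 divr_gt0.
  have d1 : d <= 1 by rewrite ge_min lexx.
  have de : d * (c *+ 2 + 1) <= e by rewrite -ler_pdivlMr // ge_min lexx orbT.
  have [p pf] := af _ d0; have [q qg] := ag _ d0.
  exists p, q, d; split=> // [|s sM]; first by rewrite d0.
  rewrite hornerM.
  have -> : p.[s] * q.[s] - f s * g s =
     (p.[s] - f s) * (q.[s] - g s) + ((p.[s] - f s) * g s + f s * (q.[s] - g s)) by ring.
  have := ler_normD ((p.[s] - f s) * (q.[s] - g s)) ((p.[s] - f s) * g s + f s * (q.[s] - g s)).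
  have := ler_normD ((p.[s] - f s) * g s) (f s * (q.[s] - g s)).
  rewrite !normrM.
  have h1 : `|p.[s] - f s| * `|q.[s] - g s| <= d * 1.
    by rewrite ler_pM ?normr_ge0 ?pf // (le_trans (qg s sM)).
  have h2 : `|p.[s] - f s| * `|g s| <= d * c by rewrite ler_pM ?normr_ge0 ?pf ?gc.
  have h3 : `|f s| * `|q.[s] - g s| <= c * d by rewrite ler_pM ?normr_ge0 ?qg ?fc.
  lra.
apply/is_fun_calcP; split; first by move=> e /close[p [q [d [_ _ _ _ h]]]]; exists (p * q).
split=> [|e r x e0 rfg]; first exact: bounded_comp.
apply/ler_addgt0Pr => e' e'0.
have [e'' e''0 h5] := exists_small_factor (rnorm_ge0 x) (half_pos e'0).
have [p [q [d [/andP[d0 d1] de pf qg pqfg]]]] := close _ e''0.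
have h1 := poly_op_close x rfg pqfg.
have h2 : rnorm (poly_op p A (poly_op q A x) - B (poly_op q A x)) <= d * rnorm (poly_op q A x).
  exact: hB.
have h3 : rnorm (B (poly_op q A x) - B (C x)) <= c * (d * rnorm x).
  rewrite -linfB //; apply: le_trans (cB _) _; rewrite ler_wpM2l //; exact: hC.
have h4 : rnorm (poly_op q A x) <= (c + 1) * rnorm x.
  rewrite -[poly_op q A x](subrK (C x)); apply: le_trans (rnormD _ _) _.
  rewrite mulrDl mul1r addrC lerD ?cC //; apply: le_trans (hC _ _ _ d0 qg) _.
  by rewrite ler_piMl ?rnorm_ge0.
have h6 : d * rnorm (poly_op q A x) <= d * ((c + 1) * rnorm x) by rewrite ler_wpM2l // ltW.
have h7 : d * (c *+ 2 + 1) * rnorm x <= e'' * rnorm x by rewrite ler_wpM2r ?rnorm_ge0.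
rewrite poly_opM // in h1.
have t1 := rdist_triangle (poly_op r A x) (poly_op p A (poly_op q A x)) (B (C x)).
have t2 := rdist_triangle (poly_op p A (poly_op q A x)) (B (poly_op q A x)) (B (C x)).
lra.
Qed.

End FunctionalCalculus.

(** * Powers and square roots of a positive operator *)

Section Powers.
Variables (R : realType) (H : completeNormedModType R[i]).
Variable dot : {dot H for Num.conj}.
Hypothesis dot_norm : forall x : H, dot x x = `|x| ^+ 2.
Variable A : H -> H.
Hypothesis posA : positive_op dot A.
Implicit Types (s t : R) (x y : H).

Let bA : bounded_op A. Proof. by case: posA. Qed.

Lemma op_powP t : 0 <= t <= 1 ->
  is_fun_calc (fun s => s `^ t) A (op_pow A t).
Proof.
move=> t01; apply: getPex; apply: (fun_calc_exists dot_norm posA) => e e0.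
exact: powR_polynomial_approximation (opnorm_ge0 A) e0.
Qed.

Lemma bounded_op_pow t : 0 <= t <= 1 -> bounded_op (op_pow A t).
Proof. by move=> /op_powP[]. Qed.

Lemma linear_op_pow t : 0 <= t <= 1 -> linear (op_pow A t).
Proof. by move=> /bounded_op_pow[]. Qed.

Lemma selfadjoint_op_pow t : 0 <= t <= 1 -> selfadjoint dot (op_pow A t).
Proof. by move=> /op_powP/(fun_calc_selfadjoint dot_norm posA). Qed.

Lemma powR_le_opnorm t s : 0 <= t <= 1 -> 0 <= s <= opnorm A ->
  `|s `^ t| <= opnorm A + 1.
Proof.
move=> /andP[t0 t1] /andP[s0 sM]; rewrite ger0_norm ?powR_ge0 //.
have M1 : 1 <= opnorm A + 1 by rewrite lerDr opnorm_ge0.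
apply: le_trans (ler1_powR M1 t1).
by apply: ge0_ler_powR; rewrite ?nnegrE //; lra.
Qed.

Lemma op_pow_norm_le t x : 0 <= t <= 1 ->
  rnorm (op_pow A t x) <= (opnorm A + 1) * rnorm x.
Proof.
move=> t01; apply: (fun_calc_norm_le dot_norm posA (op_powP t01)) => s.
exact: powR_le_opnorm.
Qed.

Lemma op_pow0 x : op_pow A 0 x = x.
Proof.
have h01 : 0 <= (0 : R) <= 1 by rewrite lexx ler01.
rewrite (fun_calc_unique dot_norm posA _ (op_powP h01) (fun_calc_poly dot_norm posA 1)).
  by rewrite poly_opC scale1r.
by move=> s _; rewrite powRr0 hornerC.
Qed.

Lemma op_pow1 x : op_pow A 1 x = A x.
Proof.
have h01 : 0 <= (1 : R) <= 1 by rewrite lexx ler01.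
rewrite (fun_calc_unique dot_norm posA _ (op_powP h01) (fun_calc_poly dot_norm posA 'X)).
  by rewrite poly_opX.
by move=> s /andP[s0 _]; rewrite powRr1 // hornerX.
Qed.

Lemma op_powD s t x : 0 <= s -> 0 <= t -> s + t <= 1 ->
  op_pow A s (op_pow A t x) = op_pow A (s + t) x.
Proof.
move=> s0 t0 st1.
have s01 : 0 <= s <= 1 by apply/andP; split; lra.
have t01 : 0 <= t <= 1 by apply/andP; split; lra.
have st01 : 0 <= s + t <= 1 by apply/andP; split; lra.
have h := fun_calcM dot_norm posA (fun u => @powR_le_opnorm s u s01)
  (fun u => @powR_le_opnorm t u t01) (op_powP s01) (op_powP t01).
apply: (fun_calc_unique dot_norm posA _ h (op_powP st01)) => u _.
have [st0|st0] := eqVneq (s + t) 0; last by rewrite powRD // (negPf st0).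
have -> : s = 0 by lra.
have -> : t = 0 by lra.
by rewrite addr0 !powRr0 mulr1.
Qed.

(** The root is [A^(1/2)]. It is positive as it is the square of the selfadjoint
    [A^(1/4)]. *)
Lemma op_sqrtP : positive_op dot (op_sqrt dot A) /\
  forall x, op_sqrt dot A (op_sqrt dot A x) = A x.
Proof.
apply: (@getPex _ [set B | positive_op dot B /\ forall x, B (B x) = A x]).
have q01 : 0 <= (4^-1 : R) <= 1 by apply/andP; split; lra.
have h01 : 0 <= (2^-1 : R) <= 1 by apply/andP; split; lra.
exists (op_pow A 2^-1); split=> [|x].
  split=> [|x]; first exact: bounded_op_pow.
  have -> : 2^-1 = 4^-1 + 4^-1 :> R by lra.
  rewrite -op_powD; [|lra..].
  by rewrite selfadjoint_op_pow // dot_norm exprn_ge0.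
rewrite op_powD; [|lra..].
have -> : 2^-1 + 2^-1 = 1 :> R by lra.
exact: op_pow1.
Qed.

End Powers.

(** * The spherical polar decomposition *)

Section Polar.
Variables (R : realType) (H : completeNormedModType R[i]).
Variable dot : {dot H for Num.conj}.
Hypothesis dot_norm : forall x : H, dot x x = `|x| ^+ 2.
Variables (d : nat).
Implicit Types (x y z : H) (T V : 'I_d -> H -> H).

Lemma dot_sum_adj_mul T x y : (forall k, bounded_op (T k)) ->
  dot (sum_adj_mul dot T x) y = \sum_(k < d) dot (T k x) (T k y).
Proof.
move=> bT; rewrite dot_suml; apply: eq_bigr => k _.
have [_ hT] := adjointP dot_norm (bT k).
by rewrite dotC -hT -dotC.
Qed.

Lemma positive_sum_adj_mul T : (forall k, bounded_op (T k)) ->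
  positive_op dot (sum_adj_mul dot T).
Proof.
move=> bT; split=> [|x]; last first.
  rewrite dot_sum_adj_mul //; apply: sumr_ge0 => k _.
  by rewrite dot_norm exprn_ge0.
apply: bounded_sum => k; apply: bounded_comp (bT k).
by have [] := adjointP dot_norm (bT k).
Qed.

Variable T : 'I_d -> H -> H.
Hypothesis T_bnd : forall k, bounded_op (T k).
Let P := polar_abs dot T.

Lemma polar_absP : positive_op dot P /\ forall x, P (P x) = sum_adj_mul dot T x.
Proof. by apply: op_sqrtP => //; exact: positive_sum_adj_mul. Qed.

Lemma polar_abs_selfadjoint : selfadjoint dot P.
Proof. by apply: positive_selfadjoint; have [] := polar_absP. Qed.

Lemma dot_polar_abs x y : dot (P x) (P y) = \sum_(k < d) dot (T k x) (T k y).
Proof.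
have [_ hP] := polar_absP.
by rewrite -polar_abs_selfadjoint hP dot_sum_adj_mul.
Qed.

Lemma rnorm_polar_abs x : rnorm (P x) ^+ 2 = \sum_(k < d) rnorm (T k x) ^+ 2.
Proof.
rewrite -(rdotxx dot_norm) /rdot dot_polar_abs cRe_sum.
by apply: eq_bigr => k _; rewrite dot_rnorm.
Qed.

Let bP : bounded_op P. Proof. by have [[]] := polar_absP. Qed.
Let lP : linear P. Proof. by case: bP. Qed.

Let rnorm_T_le k x : rnorm (T k x) <= rnorm (P x).
Proof.
rewrite -(@ler_pXn2r _ 2) ?nnegrE ?rnorm_ge0 // rnorm_polar_abs (bigD1 k) //=.
by rewrite lerDl sumr_ge0 // => j _; rewrite sqr_ge0.
Qed.

Definition range_closure (A : H -> H) z :=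
  forall e : R, 0 < e -> exists y, rnorm (A y - z) <= e.

Lemma range_closure_orth z w : (forall y, dot (P y) w = 0) -> range_closure P z ->
  dot z w = 0.
Proof.
move=> Pw hz.
have rz a : rdot dot (a *: z) w = 0.
  apply: (@eq0_small _ _ (Re `|a| * rnorm w)).
    have a0 := Re_norm_ge0 a.
    by rewrite mulr_ge0 ?rnorm_ge0.
  move=> e e0; have [y hy] := hz e e0.
  have -> : rdot dot (a *: z) w = - rdot dot (a *: (P y - z)) w.
    by rewrite /rdot !dotZl dotBl Pw sub0r mulrN cReN opprK.
  rewrite normrN; apply: le_trans (rdot_le dot_norm _ _) _.
  rewrite rnormZ mulrAC ler_wpM2l // mulr_ge0 ?rnorm_ge0 //.
  exact: Re_norm_ge0.
rewrite -(dot0l dot w); apply: dot_Re_eq => a.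
by rewrite rz /rdot scaler0 dot0l.
Qed.

(** As [|T_k y| <= |P y|], the functional [y |-> <T_k y, z>] factors through the range
    of [P], hence is [y |-> <P y, W_k z>] with [W_k z] in the closure of that range.
    Then [V_k] is the adjoint of [W_k]. *)
Lemma polar_isomP : let V := polar_isom dot T in
  [/\ forall k, bounded_op (V k), forall k x, T k x = V k (P x) &
      is_orthoproj dot (ortho_compl dot (op_ker P)) (sum_adj_mul dot V)].
Proof.
apply: (@getPex _ [set V | [/\ forall k, bounded_op (V k),
  forall k x, T k x = V k (P x) &
  is_orthoproj dot (ortho_compl dot (op_ker P)) (sum_adj_mul dot V)]]).
have /choice[W hW] k : exists W : H -> H, forall z, range_closure P (W z) /\
    forall y, dot (T k y) z = dot (P y) (W z).
  suff /choice[W hW] : forall z, exists w, range_closure P w /\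
      forall y, dot (T k y) z = dot (P y) w by exists W.
  move=> z; apply: (@riesz_representation _ _ dot dot_norm P (fun y => dot (T k y) z) (rnorm z)) => //.
    by move=> a x y; have [lT _] := T_bnd k; rewrite lT dotDl dotZl.
  move=> x; apply: le_trans (rdot_le dot_norm _ _) _.
  by rewrite mulrC ler_wpM2l ?rnorm_ge0 ?rnorm_T_le.
have rW k z : range_closure P (W k z) by have [] := hW k z.
have TW k y z : dot (T k y) z = dot (P y) (W k z) by have [_] := hW k z.
have range_closureB u v : range_closure P u -> range_closure P v -> range_closure P (u - v).
  move=> hu hv e e0; have e20 := half_pos e0.
  have [x hx] := hu _ e20; have [y hy] := hv _ e20.
  exists (x - y); rewrite linfB //.
  have -> : P x - P y - (u - v) = (P x - u) - (P y - v).
    by rewrite !opprB addrACA [RHS]addrACA [- P y + _]addrC.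
  by apply: le_trans (rnormB _ _) _; lra.
have range_closure_eq u v : range_closure P u -> range_closure P v ->
    (forall y, dot (P y) u = dot (P y) v) -> u = v.
  move=> hu hv huv; apply/eqP; rewrite -subr_eq0 -rnorm_eq0 -sqrf_eq0.
  rewrite -(rdotxx dot_norm) /rdot (@range_closure_orth _ (u - v)) //.
  - by move=> y; rewrite dotBr huv subrr.
  - exact: range_closureB.
have range_closureZ a u : range_closure P u -> range_closure P (a *: u).
  move=> hu e e0.
  have a0 := Re_norm_ge0 a.
  have [d' d'0 hd] := exists_small_factor a0 e0.
  have [x hx] := hu _ d'0; exists (a *: x).
  rewrite linfZ // -scalerBr rnormZ; apply: le_trans hd.
  by rewrite mulrC ler_wpM2r.
have range_closure0 : range_closure P 0.
  by move=> e e0; exists 0; rewrite linf0 // subrr rnorm0 ltW.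
have range_closureD u v : range_closure P u -> range_closure P v -> range_closure P (u + v).
  move=> hu hv; rewrite -[v]opprK; apply: range_closureB => //.
  by rewrite -scaleN1r; exact: range_closureZ.
have range_closure_sum (F : 'I_d -> H) : (forall k, range_closure P (F k)) ->
    range_closure P (\sum_(k < d) F k).
  by move=> hF; apply: big_ind.
have bW k : bounded_op (W k).
  apply: (@bounded_opI _ _ _ 1) => [a x y|z].
    apply: range_closure_eq => // [|w]; first exact/range_closureD/rW/range_closureZ.
    by rewrite -TW !dotDr !dotZr !TW.
  rewrite mul1r; have n0 := rnorm_ge0 (W k z).
  have [->|W0] := eqVneq (W k z) 0; first by rewrite rnorm0 rnorm_ge0.
  have nW : 0 < rnorm (W k z) by rewrite lt_neqAle rnorm_ge0 eq_sym rnorm_eq0 W0.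
  rewrite -(ler_pM2l nW) -expr2; apply/ler_addgt0Pr => e e0.
  have nn : 0 <= rnorm z + rnorm (W k z) by rewrite addr_ge0 ?rnorm_ge0.
  have [e' e'0 he'] := exists_small_factor nn e0.
  have [y hy] := rW k z e' e'0.
  have h1 : rdot dot (P y) (W k z) <= rnorm (P y) * rnorm z.
    rewrite /rdot -TW; apply: le_trans (ler_norm _) _.
    apply: le_trans (rdot_le dot_norm _ _) _.
    by rewrite ler_wpM2r ?rnorm_ge0 ?rnorm_T_le.
  have h2 := le_trans (ler_norm _) (rdot_le dot_norm (W k z - P y) (W k z)).
  rewrite rdistC in hy; have h3 := ler_wpM2r n0 hy.
  have h4 : rnorm (P y) <= rnorm (W k z) + e'.
    have := rdist_triangle (P y) (W k z) 0; rewrite !subr0 rdistC; lra.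
  have h5 := ler_wpM2r (rnorm_ge0 z) h4.
  rewrite -(rdotxx dot_norm).
  have -> : rdot dot (W k z) (W k z) = rdot dot (W k z - P y) (W k z) + rdot dot (P y) (W k z).
    by rewrite -rdotDl subrK.
  lra.
pose V k := adjoint dot (W k).
have VW k x z : dot (V k x) z = dot x (W k z).
  have [_ h] := adjointP dot_norm (bW k).
  by rewrite dotC -h -dotC.
have bV k : bounded_op (V k) by have [] := adjointP dot_norm (bW k).
have VP k x : T k x = V k (P x).
  apply: (@dot_extl _ _ dot dot_norm) => z.
  by rewrite dotC TW -VW -dotC.
have WTP x : \sum_(k < d) W k (T k x) = P x.
  apply: range_closure_eq => [||y].
  - by apply: range_closure_sum.
  - by move=> e e0; exists x; rewrite subrr rnorm0 ltW.
  - by rewrite dot_sumr dot_polar_abs; apply: eq_bigr => k _; rewrite TW.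
have QE x : sum_adj_mul dot V x = \sum_(k < d) W k (V k x).
  apply: eq_bigr => k _; apply: adjoint_unique => // u v; exact: VW.
exists V; split=> // x; rewrite QE; split=> [y|y hy].
  rewrite /op_ker /= => Py0; apply: range_closure_orth; last exact: range_closure_sum.
  by move=> w; rewrite polar_abs_selfadjoint Py0 dot0r.
rewrite dotC hy ?rmorph0 // /op_ker /=.
apply: (@dot_extl _ _ dot dot_norm) => w; rewrite dot0r.
rewrite -polar_abs_selfadjoint dotBr dot_sumr -[X in dot X x]WTP dot_suml.
rewrite -sumrB; apply: big1 => k _.
by rewrite -TW [X in X - _]dotC -VW -dotC subrr.
Qed.

End Polar.

(** * The arithmetic-geometric mean inequality for operators *)

Section ArithmeticGeometric.
Variables (R : realType) (H : completeNormedModType R[i]).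
Variable dot : {dot H for Num.conj}.
Hypothesis dot_norm : forall x : H, dot x x = `|x| ^+ 2.
Implicit Types (x y : H) (A X : H -> H).

Lemma opnorm_approx (B : H -> H) (r : R) : 0 <= r < opnorm B ->
  exists2 x, rnorm x = 1 & r < rnorm (B x).
Proof.
move=> /andP[r0 rB]; apply: contrapT => hB.
suff : opnorm B <= r by rewrite leNgt rB.
rewrite /opnorm; set S := (X in sup X).
have [->|S0] := eqVneq S set0; first by rewrite sup0.
apply: ge_sup; first exact/set0P.
move=> _ [x /eq1_rnorm x1 <-]; rewrite leNgt; apply/negP => rx.
by apply: hB; exists x.
Qed.

(** The Hermitian form [||K||^2 <x, u> - <K x, K u>] is positive semidefinite. So at
    a vector [x] where [|K x|] is nearly [||K|| |x|], the vector [K x] pairs with [K u]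
    nearly as [||K||^2 x] pairs with [u]; this replaces the adjoint of [K]. *)
Lemma norm_defect_CauchySchwarz (K : H -> H) x u : bounded_op K ->
  (opnorm K ^+ 2 * rdot dot x u - rdot dot (K x) (K u)) ^+ 2 <=
  (opnorm K ^+ 2 * rnorm x ^+ 2 - rnorm (K x) ^+ 2) *
  (opnorm K ^+ 2 * rnorm u ^+ 2 - rnorm (K u) ^+ 2).
Proof.
move=> bK; have lK := bounded_op_linear bK.
have defect_ge0 v : 0 <= opnorm K ^+ 2 * rnorm v ^+ 2 - rnorm (K v) ^+ 2.
  rewrite subr_ge0 -exprMn ler_pXn2r ?nnegrE ?mulr_ge0 ?rnorm_ge0 ?opnorm_ge0 //.
  exact: opnorm_ub.
apply: psd_CauchySchwarz => // t; have := defect_ge0 (x + t%:C *: u).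
rewrite (linfD lK) (linfZ lK) !(rnorm_sqD dot_norm) !rdotZr !rnormZr !exprMn.
rewrite real_normK ?num_real //; lra.
Qed.

(** For a unit vector [x] with [|K x|] close to [mu = ||K||], put [a = A x] and
    [b = A K x / mu]. Then [<A^2 X a, b> = mu |b|^2] exactly and
    [<X A^2 a, b> = <K A^2 x, K x> / mu] is nearly [mu |a|^2], whereas
    [<Y a, b> <= nu |a| |b| <= nu (|a|^2 + |b|^2) / 2]. Since [|K x| <= ||A|| ||X|| |a|],
    the vector [a] stays away from 0, and [2 mu <= nu] follows. *)
Lemma arithmetic_geometric_opnorm A X : bounded_op A -> bounded_op X ->
  selfadjoint dot A ->
  opnorm (fun x => A (X (A x))) *+ 2 <= opnorm (fun x => A (A (X x)) + X (A (A x))).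
Proof.
move=> bA bX sA; set K := fun x => A (X (A x)); set Y := (X in _ <= opnorm X).
have lA := bounded_op_linear bA; have lX := bounded_op_linear bX.
have bK : bounded_op K by apply: bounded_comp => //; exact: bounded_comp.
have bY : bounded_op Y.
  by apply: bounded_add; do ?apply: bounded_comp => //; exact: bounded_comp.
set mu := opnorm K; set nu := opnorm Y.
rewrite leNgt; apply/negP => numu.
have nu0 : 0 <= nu by exact: opnorm_ge0.
have mu0 : 0 < mu by lra.
have rsA u v : rdot dot (A u) v = rdot dot u (A v) by exact: rdot_selfadjoint.
pose delta := mu - nu / 2; have delta0 : 0 < delta by rewrite /delta; lra.
pose oA := opnorm A; pose c := (oA * opnorm X) ^+ 2 * oA ^+ 2.
have c0 : 0 <= c by rewrite mulr_ge0 ?sqr_ge0.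
have main x : rnorm x = 1 ->
    (delta * rnorm (K x) ^+ 2) ^+ 2 <= c ^+ 2 * (mu ^+ 2 - rnorm (K x) ^+ 2).
  move=> x1; set k := rnorm (K x) ^+ 2.
  have k_le : k <= mu ^+ 2.
    rewrite ler_pXn2r ?nnegrE ?rnorm_ge0 ?(ltW mu0) //.
    by rewrite -[mu]mulr1 -x1; exact: opnorm_ub.
  pose eta := Num.sqrt (mu ^+ 2 - k).
  have etaE : eta ^+ 2 = mu ^+ 2 - k by rewrite sqr_sqrtr // subr_ge0.
  have eta0 : 0 <= eta by exact: sqrtr_ge0.
  pose a := A x; pose b := (mu^-1)%:C *: A (K x); pose u := A (A x).
  have u_le : rnorm u <= oA ^+ 2.
    apply: le_trans (opnorm_ub _ bA) _; rewrite expr2 ler_wpM2l ?opnorm_ge0 //.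
    by apply: le_trans (opnorm_ub _ bA) _; rewrite x1 mulr1.
  pose D := mu ^+ 2 * rnorm a ^+ 2 - rdot dot (K u) (K x).
  have D_le : D <= mu * rnorm u * eta.
    apply: le_trans (ler_norm _) _.
    rewrite -(@ler_pXn2r _ 2) ?nnegrE ?mulr_ge0 ?rnorm_ge0 ?(ltW mu0) //.
    rewrite real_normK ?num_real // !exprMn etaE.
    have := norm_defect_CauchySchwarz u x bK.
    rewrite x1 expr1n mulr1 -/k -/mu rsA (rdotxx dot_norm) -/a -/D => h.
    apply: (le_trans h); rewrite ler_wpM2r ?subr_ge0 //.
    by rewrite gerBl sqr_ge0.
  have YabE : rdot dot (Y a) b = mu * rnorm b ^+ 2 + (mu ^+ 2 * rnorm a ^+ 2 - D) / mu.
    rewrite /Y rdotDl; congr (_ + _).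
      have -> : A (A (X a)) = mu%:C *: b.
        by rewrite /b scalerA -rmorphM divff ?gt_eqF // scale1r.
      by rewrite rdotZl (rdotxx dot_norm).
    rewrite /D opprB addrC subrK /b rdotZr -rsA mulrC; congr (_ * _).
  have Yab_le : rdot dot (Y a) b <= nu / 2 * (rnorm a ^+ 2 + rnorm b ^+ 2).
    apply: le_trans (ler_norm _) _; apply: le_trans (rdot_le dot_norm _ _) _.
    have h1 := ler_wpM2r (rnorm_ge0 b) (opnorm_ub a bY).
    have h2 : 0 <= nu / 2 * (rnorm a - rnorm b) ^+ 2 by rewrite mulr_ge0 ?sqr_ge0 ?divr_ge0.
    apply: (le_trans h1); rewrite -/nu; lra.
  have key : delta * (rnorm a ^+ 2 + rnorm b ^+ 2) <= rnorm u * eta.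
    have : D / mu <= rnorm u * eta by rewrite ler_pdivrMr // mulrC mulrA.
    move: Yab_le; rewrite YabE mulrBl /delta.
    have -> : mu ^+ 2 * rnorm a ^+ 2 / mu = mu * rnorm a ^+ 2 by field; rewrite gt_eqF.
    lra.
  have ka : k <= (oA * opnorm X) ^+ 2 * rnorm a ^+ 2.
    rewrite -exprMn ler_pXn2r ?nnegrE ?mulr_ge0 ?rnorm_ge0 ?opnorm_ge0 //.
    apply: le_trans (opnorm_ub _ bA) _; rewrite -mulrA ler_wpM2l ?opnorm_ge0 //.
    exact: opnorm_ub.
  have lhs0 : 0 <= delta * k by exact: mulr_ge0 (ltW delta0) (sqr_ge0 _).
  have rhs0 : 0 <= c * eta by exact: mulr_ge0.
  rewrite -etaE -exprMn ler_pXn2r ?nnegrE //.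
  apply: le_trans (ler_wpM2l (ltW delta0) ka) _.
  have h1 : rnorm u * eta <= oA ^+ 2 * eta by rewrite ler_wpM2r.
  have h2 : 0 <= delta * rnorm b ^+ 2 by rewrite mulr_ge0 ?sqr_ge0 // ltW.
  have h3 : delta * rnorm a ^+ 2 <= oA ^+ 2 * eta by lra.
  have := ler_wpM2l (sqr_ge0 (oA * opnorm X)) h3; rewrite /c; lra.
have m2 : 0 < mu ^+ 2 by exact: exprn_gt0.
have c1 : 0 < c ^+ 2 + 1 by rewrite ltr_wpDl ?sqr_ge0.
(* by [main], [|K x|^2 <= mu^2 - theta] at every unit vector [x] *)
pose theta := Num.min (mu ^+ 2 / 2) ((delta * (mu ^+ 2 / 2)) ^+ 2 / (c ^+ 2 + 1)).
have theta0 : 0 < theta.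
  by rewrite lt_min divr_gt0 //= divr_gt0 // exprn_gt0 // mulr_gt0 // divr_gt0.
have theta1 : theta <= mu ^+ 2 / 2 by rewrite ge_min lexx.
have theta2 : theta * (c ^+ 2 + 1) <= (delta * (mu ^+ 2 / 2)) ^+ 2.
  by rewrite -ler_pdivlMr // ge_min lexx orbT.
have r_lt : 0 <= Num.sqrt (mu ^+ 2 - theta) < opnorm K.
  rewrite sqrtr_ge0 /= -/mu -[ltRHS]ger0_norm ?(ltW mu0) // -sqrtr_sqr.
  by rewrite ltr_sqrt // ltrBlDr ltrDl.
have [w w1 hw] := opnorm_approx r_lt.
have := main w w1; set k := rnorm (K w) ^+ 2.
have k_gt : mu ^+ 2 - theta < k.
  have mt0 : 0 <= mu ^+ 2 - theta by lra.
  by rewrite -(sqr_sqrtr mt0) ltr_pXn2r ?nnegrE ?sqrtr_ge0 ?rnorm_ge0.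
have h1 : (delta * (mu ^+ 2 / 2)) ^+ 2 <= (delta * k) ^+ 2.
  have lhs0 : 0 <= delta * (mu ^+ 2 / 2) by rewrite mulr_ge0 ?divr_ge0 // ltW.
  have rhs0 : 0 <= delta * k by exact: mulr_ge0 (ltW delta0) (sqr_ge0 _).
  rewrite ler_pXn2r ?nnegrE //.
  by rewrite ler_wpM2l ?(ltW delta0) //; lra.
have h2 : c ^+ 2 * (mu ^+ 2 - k) <= c ^+ 2 * theta by rewrite ler_wpM2l ?sqr_ge0 //; lra.
lra.
Qed.

End ArithmeticGeometric.

(** * Heinz means of a positive operator *)

Section ConvexChord.
Variable R : realType.

(** Subtract the chord to get [g] with [g 0 = g c = 0]. A point of the left half is
    the midpoint of [0] and its double, one of the right half that of [c] and another
    point; so [g <= sup g / 2] everywhere, and [sup g <= 0]. The statement is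
    multiplied by [c] to include the degenerate interval. *)
Lemma midpoint_convex_chord (F : R -> R) (c C : R) : 0 <= c ->
  (forall t, 0 <= t <= c -> F t <= C) ->
  (forall s h, 0 <= h <= s -> s + h <= c -> F s *+ 2 <= F (s + h) + F (s - h)) ->
  forall t, 0 <= t <= c -> c * F t <= t * F c + (c - t) * F 0.
Proof.
move=> c0 FC Fmid.
pose g t := c * F t - (t * F c + (c - t) * F 0).
pose S := [set g t | t in [set t | 0 <= t <= c]].
have g_mid s h : 0 <= h <= s -> s + h <= c -> g s *+ 2 <= g (s + h) + g (s - h).
  move=> hs sh; have := ler_wpM2l c0 (Fmid s h hs sh); rewrite /g; lra.
have hS : has_sup S.
  split; first by exists (g 0), 0; rewrite //= lexx.
  exists (c * C + c * (`|F c| + `|F 0|)) => _ [t /= tc <-].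
  have := FC t tc; move/(ler_wpM2l c0) => h; have /andP[t0 t1] := tc.
  have h1 : t * (`|F c| + F c) >= 0.
    by rewrite mulr_ge0 //; have := ler_norm (- F c); rewrite normrN; lra.
  have h2 : (c - t) * (`|F 0| + F 0) >= 0.
    by rewrite mulr_ge0 ?subr_ge0 //; have := ler_norm (- F 0); rewrite normrN; lra.
  have h3 : (c - t) * `|F c| >= 0 by rewrite mulr_ge0 ?subr_ge0.
  have h4 : t * `|F 0| >= 0 by rewrite mulr_ge0.
  rewrite /g; lra.
have gS t : 0 <= t <= c -> g t <= sup S.
  by move=> tc; apply: sup_upper_bound => //; exists t.
have half t : 0 <= t <= c -> g t <= sup S / 2.
  move=> /andP[t0 tc]; have [tc2|tc2] := leP t (c / 2).
    have := @g_mid t t; rewrite t0 lexx => /(_ isT); rewrite subrr.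
    have -> : g 0 = 0 by rewrite /g; ring.
    have tt : 0 <= t + t <= c by apply/andP; split; lra.
    have := gS _ tt; lra.
  have h0 : 0 <= c - t <= t by apply/andP; split; lra.
  have := g_mid t (c - t) h0; rewrite addrC subrK => /(_ (lexx _)).
  have -> : g c = 0 by rewrite /g; ring.
  have tt : 0 <= t - (c - t) <= c by apply/andP; split; lra.
  have := gS _ tt; lra.
have supS : sup S <= sup S / 2.
  apply: ge_sup; first by case: hS.
  by move=> _ [t /half ? <-].
move=> t tc; have := gS t tc; rewrite /g; lra.
Qed.

End ConvexChord.

Lemma half_real_complex (R : realType) : (2^-1 : R[i]) = (2^-1 : R)%:C.
Proof. by rewrite fmorphV rmorph_nat. Qed.

Lemma half_scale_double (R : realType) (H : completeNormedModType R[i]) (v : H) :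
  (2^-1 : R[i]) *: (v + v) = v.
Proof.
by rewrite scalerDr -scalerDl (_ : 2^-1 + 2^-1 = 1) ?scale1r // [RHS](splitr 1) mul1r.
Qed.

Section Heinz.
Variables (R : realType) (H : completeNormedModType R[i]).
Variable dot : {dot H for Num.conj}.
Hypothesis dot_norm : forall x : H, dot x x = `|x| ^+ 2.
Variables P S : H -> H.
Hypothesis posP : positive_op dot P.
Hypothesis bS : bounded_op S.
Implicit Types (s t h : R) (x : H).

Definition heinz_mean t x :=
  (2^-1 : R[i]) *: (op_pow P t (S (op_pow P (1 - t) x)) +
                    op_pow P (1 - t) (S (op_pow P t x))).

Let le01B t : 0 <= t <= 1 -> 0 <= 1 - t <= 1.
Proof. by move=> /andP[t0 t1]; apply/andP; split; lra. Qed.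

Lemma bounded_pow_sandwich s t : 0 <= s <= 1 -> 0 <= t <= 1 ->
  bounded_op (fun x => op_pow P s (S (op_pow P t x))).
Proof.
move=> s01 t01; apply: bounded_comp; first exact: bounded_op_pow posP _ _.
by apply: bounded_comp => //; exact: bounded_op_pow posP _ _.
Qed.

Lemma bounded_heinz_mean t : 0 <= t <= 1 -> bounded_op (heinz_mean t).
Proof.
move=> t01; apply: bounded_scale; apply: bounded_add.
  exact: bounded_pow_sandwich (le01B t01).
exact: bounded_pow_sandwich (le01B t01) _.
Qed.

Lemma heinz_mean_sym t : heinz_mean (1 - t) = heinz_mean t.
Proof. by apply/funext => x; rewrite /heinz_mean subKr addrC. Qed.

Lemma heinz_mean0 x : heinz_mean 0 x = (2^-1 : R[i]) *: (S (P x) + P (S x)).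
Proof. by rewrite /heinz_mean subr0 !(op_pow0 dot_norm posP) !(op_pow1 dot_norm posP). Qed.

(** Apply the operator inequality to [A = P^h] and the operator [X] below: then
    [A X A] is the mean at [s], and [A^2 X + X A^2] is the sum of those at [s + h] and
    [s - h]. *)
Lemma heinz_mean_midpoint s h : 0 <= h <= s -> s + h <= 1 ->
  opnorm (heinz_mean s) *+ 2 <= opnorm (heinz_mean (s + h)) + opnorm (heinz_mean (s - h)).
Proof.
move=> /andP[h0 hs] sh1.
have h01 : 0 <= h <= 1 by apply/andP; split; lra.
have shm : 0 <= s - h <= 1 by apply/andP; split; lra.
have shp : 0 <= s + h <= 1 by apply/andP; split; lra.
have sh' : 0 <= 1 - s - h <= 1 by apply/andP; split; lra.
(* the mean at [s] with the factors [P^h] on both sides removed *)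
pose X x := (2^-1 : R[i]) *: (op_pow P (s - h) (S (op_pow P (1 - s - h) x)) +
                              op_pow P (1 - s - h) (S (op_pow P (s - h) x))).
have bX : bounded_op X.
  by apply: bounded_scale; apply: bounded_add; exact: bounded_pow_sandwich.
have bA : bounded_op (op_pow P h) by exact: bounded_op_pow posP _ h01.
have lA := bounded_op_linear bA.
have sA : selfadjoint dot (op_pow P h) by exact: selfadjoint_op_pow.
have powD a b c x : 0 <= a -> 0 <= b -> a + b <= 1 -> c = a + b ->
    op_pow P a (op_pow P b x) = op_pow P c x.
  by move=> a0 b0 ab ->; exact: (op_powD dot_norm posP).
have AXA : (fun x => op_pow P h (X (op_pow P h x))) = heinz_mean s.
  apply/funext => x; rewrite /X /heinz_mean (linfZ lA) (linfD lA).
  rewrite (powD h (s - h) s); [|lra..].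
  rewrite (powD h (1 - s - h) (1 - s)); [|lra..].
  rewrite (powD (1 - s - h) h (1 - s)); [|lra..].
  rewrite (powD (s - h) h s); [|lra..].
  by [].
have sum : (fun x => op_pow P h (op_pow P h (X x)) + X (op_pow P h (op_pow P h x))) =
    (fun x => heinz_mean (s + h) x + heinz_mean (s - h) x).
  apply/funext => x; rewrite /X /heinz_mean !(linfZ lA, linfD lA) -!scalerDr.
  congr (_ *: _).
  rewrite (powD h (s - h) s); [|lra..].
  rewrite (powD h s (s + h)); [|lra..].
  rewrite (powD h (1 - s - h) (1 - s)); [|lra..].
  rewrite (powD h (1 - s) (1 - (s - h))); [|lra..].
  rewrite (powD (1 - s - h) h (1 - s)); [|lra..].
  rewrite (powD (1 - s) h (1 - (s - h))); [|lra..].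
  rewrite (powD (s - h) h s); [|lra..].
  rewrite (powD s h (s + h)); [|lra..].
  have -> : 1 - s - h = 1 - (s + h) by ring.
  by rewrite -!addrA; congr (_ + _); rewrite addrCA [RHS]addrCA; congr (_ + _); rewrite addrC.
rewrite -AXA; apply: le_trans (arithmetic_geometric_opnorm dot_norm bA bX sA) _.
by rewrite sum; apply: opnorm_add; exact: bounded_heinz_mean.
Qed.

Lemma opnorm_heinz_mean_le t : 0 <= t <= 1 ->
  opnorm (heinz_mean t) <= (opnorm P + 1) ^+ 2 * opnorm S.
Proof.
move=> t01; have M0 : 0 <= opnorm P + 1 by rewrite addr_ge0 ?opnorm_ge0.
have sandwich a b x : 0 <= a <= 1 -> 0 <= b <= 1 ->
    rnorm (op_pow P a (S (op_pow P b x))) <= (opnorm P + 1) ^+ 2 * opnorm S * rnorm x.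
  move=> a01 b01; apply: le_trans (op_pow_norm_le dot_norm posP _ a01) _.
  rewrite expr2 -!mulrA ler_wpM2l //; apply: le_trans (opnorm_ub _ bS) _.
  rewrite mulrCA ler_wpM2l ?opnorm_ge0 //; exact: op_pow_norm_le.
apply: opnorm_le => [|x]; first by rewrite mulr_ge0 ?sqr_ge0 ?opnorm_ge0.
rewrite /heinz_mean half_real_complex rnormZr ger0_norm ?invr_ge0 // .
have := rnormD (op_pow P t (S (op_pow P (1 - t) x))) (op_pow P (1 - t) (S (op_pow P t x))).
have := sandwich t (1 - t) x t01 (le01B t01); have := sandwich (1 - t) t x (le01B t01) t01.
lra.
Qed.

Lemma heinz_mean_chord t : 0 <= t <= 2^-1 ->
  opnorm (heinz_mean t) <=
  2 * t * opnorm (heinz_mean 2^-1) + (1 - 2 * t) * opnorm (heinz_mean 0).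
Proof.
move=> t12; have := @midpoint_convex_chord _ (fun u => opnorm (heinz_mean u)) 2^-1
  ((opnorm P + 1) ^+ 2 * opnorm S) _ _ _ t t12.
have h0 : 0 <= 2^-1 :> R by lra.
move=> /(_ h0) h; have {h} : 2^-1 * opnorm (heinz_mean t) <=
    t * opnorm (heinz_mean 2^-1) + (2^-1 - t) * opnorm (heinz_mean 0); last by lra.
apply: h => [u u01|s h hs sh]; first by apply: opnorm_heinz_mean_le; lra.
by apply: heinz_mean_midpoint => //; lra.
Qed.

Lemma heinz_mean_half_le : opnorm (heinz_mean 2^-1) <= opnorm (heinz_mean 0).
Proof.
have h : 0 <= (2^-1 : R) <= 2^-1 by apply/andP; split; lra.
have := @heinz_mean_midpoint 2^-1 2^-1 h.
have -> : 2^-1 + 2^-1 = 1 :> R by lra.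
rewrite lexx subrr -(subr0 1) heinz_mean_sym => /(_ isT); lra.
Qed.

End Heinz.

(** * The hypo-norm *)

Section HypoNorm.
Variables (R : realType) (H : completeNormedModType R[i]) (d : nat).
Implicit Types (V : 'I_d -> H -> H) (lam : 'I_d -> R[i]) (x : H).

Lemma hypo_norm_le V (C : R) :
  (forall lam, \sum_(k < d) `|lam k| ^+ 2 <= 1 ->
     opnorm (fun x => \sum_(k < d) lam k *: V k x) <= C) -> hypo_norm V <= C.
Proof.
move=> hC; apply: ge_sup; last by move=> _ [lam /hC ? <-].
exists (opnorm (fun x => \sum_(k < d) (0 : R[i]) *: V k x)), (fun=> 0) => //=.
by rewrite big1 // => k _; rewrite normr0 expr0n.
Qed.

Lemma sum_coef_sq_le lam : \sum_(k < d) `|lam k| ^+ 2 <= 1 ->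
  \sum_(k < d) Re `|lam k| ^+ 2 <= 1.
Proof.
move=> hl; rewrite -lecR rmorph_sum /=; apply: le_trans hl.
by apply: ler_sum => k _; rewrite rmorphXn; exact: lexx.
Qed.

(** Each [|lam_k| <= 1], so the supremum is taken over a bounded set. *)
Lemma hypo_norm_ub V lam : (forall k, bounded_op (V k)) ->
  \sum_(k < d) `|lam k| ^+ 2 <= 1 ->
  opnorm (fun x => \sum_(k < d) lam k *: V k x) <= hypo_norm V.
Proof.
move=> bV hl; apply: sup_upper_bound; last by exists lam.
split; first by exists (opnorm (fun x => \sum_(k < d) lam k *: V k x)), lam.
exists (\sum_(k < d) opnorm (V k)) => _ [l /= /sum_coef_sq_le hl' <-].
have l1 k : Re `|l k| <= 1.
  rewrite -(@ler_pXn2r _ 2) ?nnegrE ?Re_norm_ge0 // expr1n; apply: le_trans hl'.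
  by rewrite (bigD1 k) //= lerDl sumr_ge0 // => j _; rewrite sqr_ge0.
apply: opnorm_le => [|x]; first by rewrite sumr_ge0 // => k _; exact: opnorm_ge0.
rewrite mulr_suml; elim/big_ind2: _ => [|u a v b ua vb|k _].
- by rewrite rnorm0.
- by apply: le_trans (rnormD _ _) _; exact: lerD.
rewrite rnormZ -[leRHS]mul1r; apply: ler_pM => //; [exact: Re_norm_ge0|exact: rnorm_ge0|].
exact: opnorm_ub.
Qed.

Lemma bounded_lincomb V lam : (forall k, bounded_op (V k)) ->
  bounded_op (fun x => \sum_(k < d) lam k *: V k x).
Proof. by move=> bV; apply: bounded_sum => k; exact: bounded_scale. Qed.

Lemma sum_CauchySchwarz (a b : 'I_d -> R) :
  (\sum_(k < d) a k * b k) ^+ 2 <= (\sum_(k < d) a k ^+ 2) * (\sum_(k < d) b k ^+ 2).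
Proof.
apply: psd_CauchySchwarz => [|t]; first by apply: sumr_ge0 => k _; rewrite sqr_ge0.
have -> : \sum_(k < d) a k ^+ 2 + t * (\sum_(k < d) a k * b k) *+ 2
    + t ^+ 2 * (\sum_(k < d) b k ^+ 2) = \sum_(k < d) (a k + t * b k) ^+ 2.
  rewrite -mulrnAr -sumrMnl !mulr_sumr -!big_split /=.
  by apply: eq_bigr => k _; ring.
by apply: sumr_ge0 => k _; rewrite sqr_ge0.
Qed.

Lemma rnorm_lincomb_le lam (v : 'I_d -> H) : \sum_(k < d) `|lam k| ^+ 2 <= 1 ->
  rnorm (\sum_(k < d) lam k *: v k) <= Num.sqrt (\sum_(k < d) rnorm (v k) ^+ 2).
Proof.
move=> /sum_coef_sq_le hl.
have n0 : 0 <= \sum_(k < d) rnorm (v k) ^+ 2.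
  by rewrite sumr_ge0 // => k _; rewrite sqr_ge0.
have le1 : rnorm (\sum_(k < d) lam k *: v k) <= \sum_(k < d) Re `|lam k| * rnorm (v k).
  elim/big_ind2: _ => [|u a w b ua wb|k _]; first by rewrite rnorm0.
    by apply: le_trans (rnormD _ _) _; exact: lerD.
  by rewrite rnormZ.
apply: (le_trans le1); apply: le_trans (ler_norm _) _.
rewrite -sqrtr_sqr ler_wsqrtr //; apply: le_trans (sum_CauchySchwarz _ _) _.
by rewrite ler_piMl.
Qed.

End HypoNorm.

(** * Comparison of the spherical transforms *)

Section Transforms.
Variables (R : realType) (H : completeNormedModType R[i]).
Variable dot : {dot H for Num.conj}.
Hypothesis dot_norm : forall x : H, dot x x = `|x| ^+ 2.
Variables (d : nat) (T : 'I_d -> H -> H).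
Hypothesis T_bnd : forall k, bounded_op (T k).
Implicit Types (t : R) (x : H) (lam : 'I_d -> R[i]).

Let P := polar_abs dot T.
Let V := polar_isom dot T.
Let S lam x := \sum_(k < d) lam k *: V k x.

Let posP : positive_op dot P. Proof. by have [] := polar_absP dot_norm T_bnd. Qed.
Let bP : bounded_op P. Proof. by case: posP. Qed.
Let lP : linear P. Proof. by case: bP. Qed.
Let bV k : bounded_op (V k). Proof. by have [] := polar_isomP dot_norm T_bnd. Qed.
Let TE k x : T k x = V k (P x). Proof. by have [_ ->] := polar_isomP dot_norm T_bnd. Qed.
Let bS lam : bounded_op (S lam). Proof. exact: bounded_lincomb. Qed.

Lemma spherical_norm_polar : spherical_norm T = opnorm P.
Proof.
rewrite /spherical_norm /opnorm; congr sup; apply: eq_imagel => x _.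
by rewrite -(rnorm_polar_abs dot_norm T_bnd) sqrtr_sqr ger0_norm ?rnorm_ge0.
Qed.

Lemma lincomb_heinz lam t : 0 <= t <= 1 ->
  (fun x => \sum_(k < d) lam k *: heinz dot T t k x) = heinz_mean P (S lam) t.
Proof.
move=> t01; have t01' : 0 <= 1 - t <= 1 by move/andP: t01 => [? ?]; apply/andP; split; lra.
have l1 := linear_op_pow dot_norm posP t01; have l2 := linear_op_pow dot_norm posP t01'.
apply/funext => x; rewrite /heinz_mean /S (linf_sum l1) (linf_sum l2).
rewrite -big_split scaler_sumr; apply: eq_bigr => k _ /=.
by rewrite (linfZ l1) (linfZ l2) -scalerDr scalerA mulrC -scalerA /heinz /gen_aluthge subKr.
Qed.

Lemma lincomb_aluthge lam :
  (fun x => \sum_(k < d) lam k *: aluthge dot T k x) = heinz_mean P (S lam) 2^-1.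
Proof.
have h01 : 0 <= (2^-1 : R) <= 1 by apply/andP; split; lra.
rewrite -lincomb_heinz //; apply/funext => x; apply: eq_bigr => k _.
have e : 1 - 2^-1 = 2^-1 :> R by lra.
rewrite /heinz /aluthge e; congr (_ *: _).
by rewrite half_scale_double.
Qed.

Lemma lincomb_mean lam :
  (fun x => \sum_(k < d) lam k *: mean_transform dot T k x) = heinz_mean P (S lam) 0.
Proof.
apply/funext => x; rewrite (heinz_mean0 dot_norm _ posP) /S (linf_sum lP) -big_split scaler_sumr.
apply: eq_bigr => k _ /=.
by rewrite (linfZ lP) -scalerDr scalerA mulrC -scalerA /mean_transform /duggal TE.
Qed.

Lemma bounded_gen_aluthge t k : 0 <= t <= 1 -> bounded_op (gen_aluthge dot T t k).
Proof.
move=> t01; have t01' : 0 <= 1 - t <= 1 by move/andP: t01 => [? ?]; apply/andP; split; lra.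
exact: (bounded_pow_sandwich dot_norm posP (bV k)).
Qed.

Lemma bounded_mean_transform k : bounded_op (mean_transform dot T k).
Proof.
apply: bounded_scale; apply: bounded_add => //.
exact: bounded_comp.
Qed.

Lemma hypo_norm_heinz_le t : 0 <= t <= 2^-1 ->
  hypo_norm (heinz dot T t) <=
  2 * t * hypo_norm (aluthge dot T) + (1 - 2 * t) * hypo_norm (mean_transform dot T).
Proof.
move=> t12; have /andP[t0 t1] := t12; apply: hypo_norm_le => lam hl.
rewrite lincomb_heinz; last by apply/andP; split; lra.
apply: le_trans (heinz_mean_chord dot_norm posP (bS lam) t12) _.
apply: lerD.
  rewrite -lincomb_aluthge; apply: ler_wpM2l; first by rewrite mulr_ge0.
  apply: hypo_norm_ub => // k; apply: bounded_gen_aluthge.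
  by apply/andP; split; lra.
rewrite -lincomb_mean; apply: ler_wpM2l; first by lra.
by apply: hypo_norm_ub => // k; exact: bounded_mean_transform.
Qed.

Lemma hypo_norm_aluthge_le :
  hypo_norm (aluthge dot T) <= hypo_norm (mean_transform dot T).
Proof.
apply: hypo_norm_le => lam hl; rewrite lincomb_aluthge.
apply: le_trans (heinz_mean_half_le dot_norm posP (bS lam)) _.
rewrite -lincomb_mean; apply: hypo_norm_ub => // k; exact: bounded_mean_transform.
Qed.

(** The left side is [<Q x, x> = |Q x|^2] for the projection [Q = sum_k adjoint(V_k) V_k]. *)
Lemma polar_isom_contractive x : \sum_(k < d) rnorm (V k x) ^+ 2 <= rnorm x ^+ 2.
Proof.
have [_ _ projV] := polar_isomP dot_norm T_bnd; have [Qx xQ] := projV x.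
set Q := sum_adj_mul dot V in projV Qx xQ.
have QQ : rdot dot (Q x) x = rnorm (Q x) ^+ 2.
  rewrite -(rdotxx dot_norm) -[X in rdot dot _ X](subrK (Q x)) rdotDr.
  by rewrite (rdotC dot (Q x)) /rdot xQ // add0r.
have VQ : rdot dot (Q x) x = \sum_(k < d) rnorm (V k x) ^+ 2.
  rewrite /rdot dot_sum_adj_mul // cRe_sum; apply: eq_bigr => k _.
  by rewrite dot_rnorm.
have := sqr_ge0 (rnorm (x - Q x)).
by rewrite -VQ (rnorm_sqB dot_norm) (rdotC dot x) -QQ; lra.
Qed.

(** [S] is a contraction by the Cauchy-Schwarz inequality in [k], and [||P||] is the
    spherical norm. *)
Lemma hypo_norm_mean_le : hypo_norm (mean_transform dot T) <= spherical_norm T.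
Proof.
rewrite spherical_norm_polar; apply: hypo_norm_le => lam hl; rewrite lincomb_mean.
have S_le x : rnorm (S lam x) <= rnorm x.
  apply: le_trans (rnorm_lincomb_le _ hl) _.
  rewrite -[leRHS]ger0_norm ?rnorm_ge0 // -sqrtr_sqr ler_wsqrtr //.
  exact: polar_isom_contractive.
apply: opnorm_le => [|x]; first exact: opnorm_ge0.
rewrite (heinz_mean0 dot_norm _ posP) half_real_complex rnormZr ger0_norm ?invr_ge0 //.
have h1 := le_trans (S_le (P x)) (opnorm_ub x bP).
have h2 := le_trans (opnorm_ub (S lam x) bP) (ler_wpM2l (opnorm_ge0 P) (S_le x)).
have := rnormD (S lam (P x)) (P (S lam x)); lra.
Qed.

End Transforms.

Theorem theorem2p4 (R : realType) (H : completeNormedModType R[i])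
    (dot : {dot H for Num.conj})
    (dot_norm : forall x : H, dot x x = `|x| ^+ 2)
    (H_sep : separable_space H)
    (d : nat) (T : 'I_d -> H -> H) (T_bnd : forall k, bounded_op (T k)) :
  (forall t : R, 0 <= t <= 1 ->
    let r0 := Num.min t (1 - t) in
    [/\ hypo_norm (heinz dot T t)
          <= 2 * r0 * hypo_norm (aluthge dot T)
             + (1 - 2 * r0) * hypo_norm (mean_transform dot T),
        2 * r0 * hypo_norm (aluthge dot T)
             + (1 - 2 * r0) * hypo_norm (mean_transform dot T)
          <= hypo_norm (mean_transform dot T) &
        hypo_norm (mean_transform dot T) <= spherical_norm T]) /\
  (hypo_norm (aluthge dot T) <= hypo_norm (mean_transform dot T) /\
   hypo_norm (mean_transform dot T) <= spherical_norm T).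
Proof.
have AM := hypo_norm_aluthge_le dot_norm T_bnd.
have MT := hypo_norm_mean_le dot_norm T_bnd.
split=> // t /andP[t0 t1] r0.
have [r00 r0h] : 0 <= r0 /\ r0 <= 2^-1.
  by rewrite /r0 /Num.min; case: ltP => ?; split; lra.
split=> //; last first.
  have := ler_wpM2l (mulr_ge0 (ler0n R 2) r00) AM; lra.
have -> : heinz dot T t = heinz dot T r0.
  rewrite /r0 /Num.min; case: ltP => // _.
  by apply/funext => k; apply/funext => x; rewrite /heinz subKr addrC.
by apply: hypo_norm_heinz_le => //; rewrite r00.
Qed.
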